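(* Let $m,n$ be positive integers, let $N={\bf P}(m+n,m)$ and let $\hat{\mathcal E}_{m,n}=\{\hat\phi_1,\hat\phi_2,\dots,\hat\phi_N\}$ be the family of functions $\hat\phi_\pi$, $\pi\in\Pi_{m,n}$, on the unitary group $U(m+n)$. If $P,Q:\mathbb C^N\to\mathbb C$ are linearly independent homogeneous polynomials of the same positive degree, then the quotient $$\hat\Phi=\frac{P(\hat\phi_1,\dots,\hat\phi_N)}{Q(\hat\phi_1,\dots,\hat\phi_N)}$$ is a non-constant harmonic morphism on the open and dense subset $$\mathcal Z_Q=\{p\in U(m+n)\ |\ Q(\hat\phi_1(p),\dots,\hat\phi_N(p))\ne0\}.$$ This induces a non-constant harmonic morphism $\Phi:\mathbf{pr}(\mathcal Z_Q)\to\mathbb C$ on the open and dense subset $\mathbf{pr}(\mathcal Z_Q)$ of the complex Grassmannian $G_m(\mathbb C^{m+n})=U(m+n)/U(m)\times U(n)$, where $\mathbf{pr}:U(m+n)\to G_m(\mathbb C^{m+n})$ is the natural projection.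
   Context: A map $\phi:(M,g)\to(N,h)$ between Riemannian manifolds is a harmonic morphism if for every harmonic function $f:U\to\mathbb R$ on an open subset $U$ of $N$ with $\phi^{-1}(U)$ non-empty, the composition $f\circ\phi:\phi^{-1}(U)\to\mathbb R$ is harmonic. For the Euclidean plane $\mathbb C$ as codomain, this is equivalent to $\tau(\phi)=0$ and $\kappa(\phi,\phi)=0$, where $\tau(\phi)=\operatorname{div}(\nabla\phi)$ is the Laplace-Beltrami operator and $\kappa(\phi,\psi)=g(\nabla\phi,\nabla\psi)$ with $g$ extended complex-bilinearly. The unitary group $U(m+n)=\{z\in\mathbb C^{(m+n)\times(m+n)}\ |\ z\bar z^t=I\}$ carries the biinvariant Riemannian metric induced by $g(Z,W)=\operatorname{Re}\operatorname{trace}(Z\bar W^t)$ on its Lie algebra. The subgroup $U(m)\times U(n)$ consists of block-diagonal matrices and acts by right multiplication; the quotient carries the metric for which $\mathbf{pr}$ is a Riemannian submersion. $\Pi_{m,n}$ is the set of tuples $\pi=(r_1,\dots,r_m)$ of integers with $1\le r_1<r_2<\dots<r_m\le m+n$, and ${\bf P}(m+n,m)$ is the number of elements of $\Pi_{m,n}$. For $\pi\in\Pi_{m,n}$, $\hat\phi_\pi:U(m+n)\to\mathbb C$ is the $m\times m$ minor $$\hat\phi_\pi(z)=\det\begin{bmatrix} z_{r_1,1}&\dots&z_{r_1,m}\\ \vdots&\ddots&\vdots\\ z_{r_m,1}&\dots&z_{r_m,m}\end{bmatrix}.$$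
   Formalization: P and Q are assumed linearly independent as functions P(φ̂), Q(φ̂) on U(m+n), not merely as polynomials: by the Plücker relations, independent polynomials can give an empty Z_Q or a constant quotient when m,n ≥ 2. *)

(* Defs.v *)
From HB Require Import structures.
From mathcomp Require Import all_boot all_order all_algebra spectral complex.
From mathcomp Require mpoly.
From mathcomp Require Import all_classical all_reals all_analysis.

Set Implicit Arguments.
Unset Strict Implicit.
Unset Printing Implicit Defensive.

Import Order.TTheory GRing.Theory Num.Theory.
Import numFieldNormedType.Exports.

Local Open Scope ring_scope.
Local Open Scope classical_set_scope.
Local Open Scope complex_scope.
Local Open Scope sesquilinear_scope.

(* R[i] does not inherit the generic topology of a numClosedFieldType by
   itself; this is the topology of the modulus. *)
HB.instance Definition _ (R : realType) :=
  PseudoPointedMetric.copy R[i] (R[i] : numClosedFieldType).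
HB.instance Definition _ (R : realType) :=
  NormedModule.copy R[i] (R[i] : numClosedFieldType).

Section Coordinates.
Context {R : realType} {d : nat}.
Implicit Types (u : 'rV[R]_d -> R) (x : 'rV[R]_d) (W : set 'rV[R]_d).

Definition pderiv u (i : 'I_d) x : R := 'D_(delta_mx 0 i) u x.

Fixpoint Ck (k : nat) W u : Prop :=
  (forall x, W x -> {for x, continuous u}) /\
  match k with
  | 0%N => True
  | k'.+1 => forall i,
      (forall x, W x -> derivable u x (delta_mx 0 i)) /\ Ck k' W (pderiv u i)
  end.

Definition smooth_on W u : Prop := forall k, Ck k W u.

(* g is a matrix of metric coefficients (g_ij) in local coordinates. *)
Implicit Type g : 'rV[R]_d -> 'M[R]_d.

(* Gamma^k_ij = 1/2 sum_l g^kl (d_i g_jl + d_j g_il - d_l g_ij) *)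
Definition christoffel g (k i j : 'I_d) x : R :=
  2^-1 * \sum_l invmx (g x) k l *
    (pderiv (fun y => g y j l) i x + pderiv (fun y => g y i l) j x
     - pderiv (fun y => g y i j) l x).

Definition gradient g u (k : 'I_d) x : R :=
  \sum_l invmx (g x) k l * pderiv u l x.

(* The trace of the covariant derivative of V for the Levi-Civita
   connection: div V = sum_i (d_i V^i + sum_k Gamma^i_ik V^k). *)
Definition divergence g (V : 'I_d -> 'rV[R]_d -> R) x : R :=
  \sum_i (pderiv (V i) i x + \sum_k christoffel g i i k x * V k x).

Definition laplace_beltrami g u x : R := divergence g (gradient g u) x.

End Coordinates.

(* A Riemannian manifold presented by its local parametrisations (inverses of
   charts), each with its domain of validity and its metric coefficients.
   The values of [cmap] and [metric] outside [cdom] are irrelevant. *)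
Record riemannian (R : realType) := Riemannian {
  points :> topologicalType;
  dimension : nat;
  chart : Type;
  cdom : chart -> set 'rV[R]_dimension;
  cmap : chart -> 'rV[R]_dimension -> points;
  metric : chart -> 'rV[R]_dimension -> 'M[R]_dimension
}.

Section HarmonicMorphisms.
Context {R : realType}.

(* f is a harmonic function on the open set O; f is total, but only its values
   on O matter. *)
Definition harmonic (M : riemannian R) (O : set M) (f : M -> R) : Prop :=
  forall c : chart M,
    let W := cdom c `&` cmap c @^-1` O in
    let u := f \o cmap c in
    Ck 2 W u /\ forall x, W x -> laplace_beltrami (metric c) u x = 0.

(* phi is a harmonic morphism from the open subset A of M to N. *)
Definition harmonic_morphism (M N : riemannian R) (A : set M) (phi : M -> N)
    : Prop :=
  forall (V : set N) (f : N -> R),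
    open V -> A `&` phi @^-1` V !=set0 -> harmonic V f ->
    harmonic (A `&` phi @^-1` V) (f \o phi).

End HarmonicMorphisms.

Definition nonconstant_on (S T : Type) (A : set S) (phi : S -> T) : Prop :=
  exists x y, [/\ A x, A y & phi x <> phi y].

(* The Euclidean plane, with the standard global coordinates. *)
Definition plane (R : realType) : riemannian R :=
  @Riemannian R R[i] 2 unit
    (fun _ => setT) (fun _ x => x 0 0 +i* x 0 1) (fun _ _ => 1%:M).

Section UnitaryGroup.
Context {R : realType} {k : nat}.

Definition unitary_set : set 'M[R[i]]_k := [set z | z \is unitarymx].

(* U(k), with the topology induced by the one of matrices. *)
Definition unitary : Type := set_type unitary_set.

HB.instance Definition _ := Topological.on unitary.

Definition umx (p : unitary) : 'M[R[i]]_k := set_val p.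

Definition inner (Z W : 'M[R[i]]_k) : R := complex.Re (\tr (Z *m W ^t*)).

Definition mx_pderiv d (s : 'rV[R]_d -> unitary) (i : 'I_d) (x : 'rV[R]_d)
    : 'M[R[i]]_k :=
  \matrix_(a, b) (pderiv (fun y => complex.Re (umx (s y) a b)) i x
               +i* pderiv (fun y => complex.Im (umx (s y) a b)) i x).

(* The left translate s^-1 d_i s, in the Lie algebra of U(k), of the tangent
   vector d_i s. *)
Definition left_translate d (s : 'rV[R]_d -> unitary) (i : 'I_d)
    (x : 'rV[R]_d) : 'M[R[i]]_k :=
  (umx (s x)) ^t* *m mx_pderiv s i x.

(* The metric coefficients in the coordinates s, the length of a tangent vector
   being that of the image under [hor] of its left translate. *)
Definition gram (hor : 'M[R[i]]_k -> 'M[R[i]]_k) d (s : 'rV[R]_d -> unitary)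
    (x : 'rV[R]_d) : 'M[R]_d :=
  \matrix_(i, j) inner (hor (left_translate s i x)) (hor (left_translate s j x)).

(* Let pr : U(k) -> X be the identity or the projection to a quotient, and hor
   the orthogonal projection of the Lie algebra onto the horizontal space at the
   identity, i.e. the orthogonal complement of the kernel of the differential of
   pr.  If d = dim X, then pr \o lmap is a local parametrisation of X: it is
   smooth and injective on ldom, and the last condition says that it is an
   immersion.  As pr is a submersion, every local parametrisation of X has
   locally a lift lmap. *)
Record lifted_chart (X : Type) (pr : unitary -> X)
    (hor : 'M[R[i]]_k -> 'M[R[i]]_k) (d : nat) := LiftedChart {
  ldom : set 'rV[R]_d;
  lmap : 'rV[R]_d -> unitary;
  ldom_open : open ldom;
  lmap_smooth : forall a b,
    smooth_on ldom (fun x => complex.Re (umx (lmap x) a b)) /\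
    smooth_on ldom (fun x => complex.Im (umx (lmap x) a b));
  lmap_inj : {in ldom &, injective (pr \o lmap)};
  lmap_immersion : forall x, ldom x -> gram hor lmap x \in unitmx
}.

(* X with the Riemannian metric for which pr is a Riemannian submersion: the
   differential of pr is isometric on horizontal vectors. *)
Definition submersed (X : topologicalType) (pr : unitary -> X)
    (hor : 'M[R[i]]_k -> 'M[R[i]]_k) (d : nat) : riemannian R :=
  @Riemannian R X d (lifted_chart pr hor d)
    (fun c => ldom c) (fun c => pr \o lmap c) (fun c => gram hor (lmap c)).

End UnitaryGroup.

Arguments unitary : clear implicits.

(* U(k) with its biinvariant metric; the dimension is k^2. *)
Definition unitary_manifold (R : realType) (k : nat) : riemannian R :=
  @submersed R k (unitary R k) id id (k ^ 2)%N.

Section Grassmannian.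
Context {R : realType} {m n : nat}.

Definition block_unitary : set 'M[R[i]]_(m + n) :=
  [set h | exists A B, [/\ A \is unitarymx, B \is unitarymx &
                           h = block_mx A 0 0 B]].

Definition same_coset (p q : unitary R (m + n)) : bool :=
  `[< exists2 h, block_unitary h & umx q = umx p *m h >].

Lemma same_coset_refl : reflexive same_coset.
Proof.
move=> p; apply/asboolP; exists 1%:M; last by rewrite mulmx1.
exists 1%:M, 1%:M; split; last by rewrite -scalar_mx_block.
- by apply/unitarymxP; rewrite mul1mx trmx1 map_mx1.
- by apply/unitarymxP; rewrite mul1mx trmx1 map_mx1.
Qed.

Lemma same_coset_sym : symmetric same_coset.
Proof.
suff h p q : same_coset p q -> same_coset q p.
  by move=> p q; apply/idP/idP; exact: h.
move=> /asboolP[_ [A [B [uA uB ->]]] qE]; apply/asboolP.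
exists (block_mx (A ^t*) 0 0 (B ^t*)).
  exists (A ^t*), (B ^t*); split; [| |reflexivity].
  - by rewrite trmxC_unitary.
  - by rewrite trmxC_unitary.
rewrite qE -mulmxA mulmx_block !mulmx0 !mul0mx !addr0 !add0r.
by rewrite (unitarymxP uA) (unitarymxP uB) -scalar_mx_block mulmx1.
Qed.

Lemma same_coset_trans : transitive same_coset.
Proof.
move=> q p r /asboolP[_ [A [B [uA uB ->]]] qE].
move=> /asboolP[_ [C [D [uC uD ->]]] rE]; apply/asboolP.
exists (block_mx (A *m C) 0 0 (B *m D)).
  exists (A *m C), (B *m D); split; [| |reflexivity].
  - exact: mul_unitarymx.
  - exact: mul_unitarymx.
by rewrite rE qE -mulmxA mulmx_block !mulmx0 !mul0mx !addr0 !add0r.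
Qed.

Canonical same_coset_equiv :=
  EquivRel same_coset same_coset_refl same_coset_sym same_coset_trans.

(* G_m(C^(m+n)) = U(m+n) / (U(m) x U(n)), with the quotient topology. *)
Definition grassmannian : Type :=
  quotient_topology {eq_quot same_coset_equiv}%qT.

HB.instance Definition _ := Topological.on grassmannian.

Definition pr (p : unitary R (m + n)) : grassmannian :=
  (\pi_(quotient_topology {eq_quot same_coset_equiv}) p)%qT.

(* The orthogonal projection of u(m+n) onto the complement of u(m) + u(n). *)
Definition off_diagonal (Z : 'M[R[i]]_(m + n)) : 'M[R[i]]_(m + n) :=
  block_mx 0 (ursubmx Z) (dlsubmx Z) 0.

End Grassmannian.

Arguments grassmannian : clear implicits.

(* The real dimension of G_m(C^(m+n)) is 2mn. *)
Definition grassmannian_manifold (R : realType) (m n : nat) : riemannian R :=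
  @submersed R (m + n) (grassmannian R m n) pr off_diagonal (2 * m * n)%N.

Section Minors.
Context {R : realType} {m n : nat}.

(* Rows are numbered from 0 to m + n - 1. *)
Definition row_choice : Type :=
  {r : m.-tuple 'I_(m + n) | sorted (fun i j : 'I_(m + n) => (i < j)%N) r}.

HB.instance Definition _ := Finite.on row_choice.

Definition num_choices : nat := #|{: row_choice}|.

Definition phi_hat (r : row_choice) (z : unitary R (m + n)) : R[i] :=
  \det (\matrix_(i < m, j < m) umx z (tnth (val r) i) (lshift n j)).

(* P(phi_1, ..., phi_N), the row choices being enumerated by enum_val. *)
Definition poly_phi (P : mpoly.mpoly num_choices R[i]) (z : unitary R (m + n))
    : R[i] :=
  mpoly.meval (fun i : 'I_num_choices => phi_hat (enum_val i) z) P.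

(* Linear independence of P and Q as polynomials in the functions phi_r on
   U(m+n).  It implies linear independence in the polynomial ring, and is
   equivalent to it when m = 1 or n = 1.  Otherwise the phi_r satisfy the
   Pluecker relations, and independence in the polynomial ring would allow Q to
   be a relation, or P - Q to be one: the quotient P(phi)/Q(phi) would then be
   nowhere defined, or constant. *)
Definition independent_on_unitary (P Q : mpoly.mpoly num_choices R[i]) : Prop :=
  forall a b : R[i],
    (forall z, a * poly_phi P z + b * poly_phi Q z = 0) -> a = 0 /\ b = 0.

Definition Zset (Q : mpoly.mpoly num_choices R[i]) : set (unitary R (m + n)) :=
  [set z | poly_phi Q z != 0].

Definition Phi_hat (P Q : mpoly.mpoly num_choices R[i])
    (z : unitary R (m + n)) : R[i] :=
  poly_phi P z / poly_phi Q z.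

End Minors.

Arguments row_choice : clear implicits.
Arguments num_choices : clear implicits.

Section Homogeneous.
(* For the canonical structure of mdeg; the notations of mpoly clash with those
   of MathComp-Analysis. *)
Import -(notations) mpoly.

Definition homogeneous (R : realType) (N d : nat) (P : mpoly N R[i]) : bool :=
  P \is ishomog1 d mdeg.

End Homogeneous.

(* Main.v *)
Require Import Defs.
From HB Require Import structures.
From mathcomp Require Import all_boot all_order all_algebra spectral complex.
From mathcomp Require mpoly.
From mathcomp Require Import all_classical all_reals all_analysis.
From mathcomp Require Import perm ring lra.

(* In a local parametrisation s of the unitary group or of the Grassmannian, the
   derivatives of a function F(s) are sums of (E_i)_ab L_ab F, where
   E_i = s^-1 d_i s and L_ab is the left-invariant field sum_c z_ca d/dz_cb.  A
   minor on the first m columns is an eigenvector of L_ab unless b < m <= a, so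
   for p = P(phi) and q = Q(phi) the derivative G_ab of p / q along L_ab vanishes
   unless b < m <= a.  The horizontal parts e_i of the E_i are as many as the
   matrix positions they occupy, hence
     sum_ij g^ij (e_i)_ab (e_j)_cd = - [a = d] [b = c].
   So kappa(p/q, p/q) = - sum_ab G_ab G_ba = 0.  In the tension the second-order
   terms reduce to L_ba G_ab = G_bb - G_aa = 0, and the first-order terms are the
   pairing of G with a horizontal matrix, which the Maurer-Cartan equation shows
   to be orthogonal to every e_c, hence zero.

   If Q(phi) vanishes near a unitary matrix, it vanishes along a rational path of
   unitary matrices from there to a unit multiple of any given one, hence
   everywhere: so Z_Q is dense, and the same argument for P - c Q shows that the
   quotient is not constant. *)

Set Implicit Arguments.
Unset Strict Implicit.
Unset Printing Implicit Defensive.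

Import Order.TTheory GRing.Theory Num.Theory.
Import numFieldNormedType.Exports.

Local Open Scope ring_scope.
Local Open Scope classical_set_scope.

Local Open Scope sesquilinear_scope.

(** * Functions of class C^k *)

Section CkTheory.
Context {R : realType} {d : nat}.
Implicit Types (u v : 'rV[R]_d -> R) (x y : 'rV[R]_d) (W : set 'rV[R]_d).
Local Notation e_ i := (delta_mx 0 i : 'rV[R]_d).

(** The minors are polynomials in the entries of z, without conjugates. So, although the E_i are
    skew-Hermitian, the derivative of F(s) is complex-linear in E_i: all the fields L_ab of gl_k(C)
    may be used, and their brackets are computed formally in a polynomial ring. On skew-Hermitian
    matrices the metric is - tr(XY), bilinear as well, whence the sign of the contraction. The
    obstacle is that charts are arbitrary. No frame is adapted to them, and a chart of the
    Grassmannian is given by a lift whose velocity has an uncontrolled vertical part. The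
    Christoffel symbols must therefore be matched with brackets: lowering the index of the
    first-order coefficients leaves only first derivatives of the Gram matrix, and the vertical
    parts enter through commutators alone. Both manifolds are treated at once: a relation [v] marks
    the vertical matrix positions, none for U(k), the diagonal blocks for the Grassmannian. It has
    to be symmetric, transitive and contained in the parabolic positions. The unit multiple arises
    because the Cayley path from 1 to V requires 1 + V to be invertible. A phase achieves this, and
    costs a homogeneous polynomial only a nonzero factor. *)

Lemma Ck_continuous k W u x : Ck k W u -> W x -> {for x, continuous u}.
Proof. by case: k => [|k] [uc _] /uc. Qed.

Lemma Ck_derivable k W u x i : Ck k.+1 W u -> W x -> derivable u x (e_ i).
Proof. by move=> [_ /(_ i)[ud _]] /ud. Qed.

Arguments Ck_derivable {k W u x} i.

Lemma Ck_pderiv k W u i : Ck k.+1 W u -> Ck k W (pderiv u i).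
Proof. by move=> [_ /(_ i)[]]. Qed.

Lemma CkS k W u : Ck k.+1 W u -> Ck k W u.
Proof.
elim: k u => [|k IH] u [uc ud]; split => // i.
by have [udi upi] := ud i; split => //; exact: IH.
Qed.

Lemma Ck_subset k W W' u : W' `<=` W -> Ck k W u -> Ck k W' u.
Proof.
move=> sW; elim: k u => [|k IH] u [uc ud]; split => //.
- by move=> x /sW/uc.
- by move=> x /sW/uc.
- move=> i; have [udi upi] := ud i.
  by split; [move=> x /sW/udi | exact: IH].
Qed.

Lemma open_eq_near W u v x : open W -> W x -> (forall y, W y -> u y = v y) ->
  {near x, u =1 v}.
Proof. by move=> oW Wx uv; apply: filterS (open_nbhs_nbhs (conj oW Wx)). Qed.

Lemma pderiv_congr W u v i x : open W -> (forall y, W y -> u y = v y) -> W x ->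
  pderiv u i x = pderiv v i x.
Proof.
by move=> oW uv Wx; apply: near_eq_derive; move: (open_eq_near oW Wx uv) => h; apply: h.
Qed.

Lemma Ck_congr k W u v : open W -> (forall x, W x -> u x = v x) ->
  Ck k W u -> Ck k W v.
Proof.
move=> oW; elim: k u v => [|k IH] u v uv [uc ud].
  split=> // x Wx; rewrite /prop_for /continuous_at -(uv _ Wx).
  by apply: cvg_trans (uc x Wx); exact: (near_eq_cvg (open_eq_near oW Wx uv)).
split=> [x Wx|i].
  rewrite /prop_for /continuous_at -(uv _ Wx).
  by apply: cvg_trans (uc x Wx); exact: (near_eq_cvg (open_eq_near oW Wx uv)).
have [udi upi] := ud i; split=> [x Wx|].
  by apply: near_eq_derivable (udi x Wx); exact: (open_eq_near oW Wx uv).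
by apply: IH upi => x Wx; exact: pderiv_congr oW uv Wx.
Qed.

Lemma pderiv_cst (c : R) i x : pderiv (fun=> c) i x = 0.
Proof. exact: derive_cst. Qed.

Lemma Ck_cst k W (c : R) : Ck k W (fun=> c).
Proof.
elim: k c => [|k IH] c; split=> //.
- by move=> x _; exact: cst_continuous.
- by move=> x _; exact: cst_continuous.
- move=> i; split=> [x _|]; first exact: derivable_cst.
  by rewrite (_ : pderiv _ i = fun=> 0)//; apply/funext => x; exact: pderiv_cst.
Qed.

Lemma pderivD u v i x : derivable u x (e_ i) -> derivable v x (e_ i) ->
  pderiv (fun y => u y + v y) i x = pderiv u i x + pderiv v i x.
Proof. exact: deriveD. Qed.

Lemma pderivM u v i x : derivable u x (e_ i) -> derivable v x (e_ i) ->
  pderiv (fun y => u y * v y) i x = pderiv u i x * v x + u x * pderiv v i x.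
Proof.
move=> du dv; rewrite /pderiv (deriveM du dv) /GRing.scale /=.
by rewrite [v x * _]mulrC addrC.
Qed.

Lemma pderivV u i x : u x != 0 -> derivable u x (e_ i) ->
  pderiv (fun y => (u y)^-1) i x = - (u x)^-1 * ((u x)^-1 * pderiv u i x).
Proof.
move=> u0 du; rewrite /pderiv (deriveV u0 du) /GRing.scale /=.
by rewrite expr2 invfM !mulNr mulrA.
Qed.

Lemma CkD k W u v : open W -> Ck k W u -> Ck k W v -> Ck k W (fun x => u x + v x).
Proof.
move=> oW; elim: k u v => [|k IH] u v cu cv; split=> //.
- by move=> x Wx; exact: (continuousD (Ck_continuous cu Wx) (Ck_continuous cv Wx)).
- by move=> x Wx; exact: (continuousD (Ck_continuous cu Wx) (Ck_continuous cv Wx)).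
move=> i; split=> [x Wx|].
  exact: (derivableD (Ck_derivable i cu Wx) (Ck_derivable i cv Wx)).
apply: Ck_congr (IH _ _ (Ck_pderiv i cu) (Ck_pderiv i cv)) => // x Wx.
by rewrite (pderivD (Ck_derivable i cu Wx) (Ck_derivable i cv Wx)).
Qed.

Lemma CkM k W u v : open W -> Ck k W u -> Ck k W v -> Ck k W (fun x => u x * v x).
Proof.
move=> oW; elim: k u v => [|k IH] u v cu cv; split=> //.
- by move=> x Wx; exact: (continuousM (Ck_continuous cu Wx) (Ck_continuous cv Wx)).
- by move=> x Wx; exact: (continuousM (Ck_continuous cu Wx) (Ck_continuous cv Wx)).
move=> i; split=> [x Wx|].
  exact: (derivableM (Ck_derivable i cu Wx) (Ck_derivable i cv Wx)).
apply: Ck_congr (CkD oW (IH _ _ (Ck_pderiv i cu) (CkS cv))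
  (IH _ _ (CkS cu) (Ck_pderiv i cv))) => // x Wx.
by rewrite (pderivM (Ck_derivable i cu Wx) (Ck_derivable i cv Wx)).
Qed.

Lemma CkZ k W (c : R) u : open W -> Ck k W u -> Ck k W (fun x => c * u x).
Proof. by move=> oW cu; apply: CkM => //; exact: Ck_cst. Qed.

Lemma CkN k W u : open W -> Ck k W u -> Ck k W (fun x => - u x).
Proof.
move=> oW cu; apply: Ck_congr (CkZ (-1) oW cu) => // x _.
by rewrite mulN1r.
Qed.

Lemma CkB k W u v : open W -> Ck k W u -> Ck k W v -> Ck k W (fun x => u x - v x).
Proof. by move=> oW cu cv; apply: CkD => //; exact: CkN. Qed.

(** The derivative of 1/u is a product of u' with two copies of 1/u, which are of class C^k by
    induction. *)
Lemma CkV k W u : open W -> (forall x, W x -> u x != 0) -> Ck k W u ->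
  Ck k W (fun x => (u x)^-1).
Proof.
move=> oW u0; elim: k => [|k IH] cu; split=> //.
- by move=> x Wx; exact: (continuousV (u0 _ Wx) (Ck_continuous cu Wx)).
- by move=> x Wx; exact: (continuousV (u0 _ Wx) (Ck_continuous cu Wx)).
have IHc := IH (CkS cu).
move=> i; split=> [x Wx|].
  exact: (derivableV (u0 _ Wx) (Ck_derivable i cu Wx)).
apply: Ck_congr (CkM oW (CkN oW IHc) (CkM oW IHc (Ck_pderiv i cu))) => // x Wx.
by rewrite (pderivV (u0 _ Wx) (Ck_derivable i cu Wx)).
Qed.

Lemma Ck_sum k W (I : Type) (r : seq I) (P : pred I) (u_ : I -> 'rV[R]_d -> R) :
  open W -> (forall j, Ck k W (u_ j)) ->
  Ck k W (fun x => \sum_(j <- r | P j) u_ j x).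
Proof.
move=> oW cu; elim: r => [|j r IH].
  by apply: Ck_congr (Ck_cst k W 0) => // x _; rewrite big_nil.
case: (boolP (P j)) => Pj.
  by apply: Ck_congr (CkD oW (cu j) IH) => // x _; rewrite big_cons Pj.
by apply: Ck_congr IH => // x _; rewrite big_cons (negbTE Pj).
Qed.

Lemma derivable_sum_seq (I : Type) (r : seq I) (P : pred I)
    (u_ : I -> 'rV[R]_d -> R) i x :
  (forall j, derivable (u_ j) x (e_ i)) ->
  derivable (fun y => \sum_(j <- r | P j) u_ j y) x (e_ i).
Proof.
move=> du; elim: r => [|j r IH].
  by under eq_fun do rewrite big_nil; exact: derivable_cst.
have [Pj|/negbTE Pj] := boolP (P j).
  rewrite (_ : (fun y => _) = u_ j + (fun y => \sum_(j <- r | P j) u_ j y)).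
    exact: (derivableD (du j) IH).
  by apply/funext => y; rewrite big_cons Pj.
rewrite (_ : (fun y => _) = (fun y => \sum_(j <- r | P j) u_ j y)); first exact: IH.
by apply/funext => y; rewrite big_cons Pj.
Qed.

Lemma pderiv_sum (I : Type) (r : seq I) (P : pred I) (u_ : I -> 'rV[R]_d -> R) i x :
  (forall j, derivable (u_ j) x (e_ i)) ->
  pderiv (fun y => \sum_(j <- r | P j) u_ j y) i x =
  \sum_(j <- r | P j) pderiv (u_ j) i x.
Proof.
move=> du; elim: r => [|j r IH].
  under eq_fun do rewrite big_nil; rewrite big_nil; exact: pderiv_cst.
under eq_fun do rewrite big_cons; rewrite big_cons; case: (P j) => //.
by rewrite pderivD ?IH//; exact: derivable_sum_seq.
Qed.

End CkTheory.

Arguments Ck_derivable {R d k W u x} i.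

(** * Mean values, Caratheodory slopes, symmetry of second derivatives and the chain rule *)

Section StrictDifferentiability.
Context {R : realType} {d : nat}.
Implicit Types (u v : 'rV[R]_d -> R) (x y z : 'rV[R]_d) (W : set 'rV[R]_d).
Local Notation e_ i := (delta_mx 0 i : 'rV[R]_d).

Lemma is_derive_line u x (e : 'rV[R]_d) (t : R) : derivable u (t *: e + x) e ->
  is_derive t 1 (fun s => u (s *: e + x)) ('D_e u (t *: e + x)).
Proof.
have E : (fun h : R => h^-1 *: (((fun s : R => u (s *: e + x)) \o shift t) (h *: 1)
    - (fun s : R => u (s *: e + x)) t)) =
  (fun h : R => h^-1 *: ((u \o shift (t *: e + x)) (h *: e) - u (t *: e + x))).
  apply/funext => h /=; congr (_ *: (u _ - _)).
  by rewrite /GRing.scale /= mulr1 [RHS]addrA -[in RHS]scalerDl.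
move=> du; split; rewrite /derivable /derive E //.
Qed.

(** Absolute values cover both signs of h, as increments of coordinates have no prescribed sign.
    Derivability up to the endpoints provides the continuity that the one-variable theorem asks
    for. *)
Lemma pderiv_MVT u i x (h : R) :
  (forall t : R, `|t| <= `|h| -> derivable u (t *: e_ i + x) (e_ i)) ->
  exists2 t, `|t| <= `|h| &
    u (h *: e_ i + x) - u x = h * pderiv u i (t *: e_ i + x).
Proof.
move=> du.
have cont t : `|t| <= `|h| -> {for t, continuous (fun s : R => u (s *: e_ i + x) : R)}.
  move=> th; apply: differentiable_continuous; apply/derivable1_diffP.
  by have [] := is_derive_line (du _ th).
have := ler_norm h; have := ler_norm (- h); rewrite normrN => hl hr.
have [h0|h0] := leP 0 h.
- have ab t : t \in `[0, h]%R -> `|t| <= `|h|.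
    by rewrite in_itv/= => /andP[t0 th]; rewrite !ger0_norm.
  have hd t : t \in `]0, h[%R ->
      is_derive t 1 (fun s : R => u (s *: e_ i + x)) (pderiv u i (t *: e_ i + x)).
    by move=> tI; apply: is_derive_line; apply: du; apply: ab; exact: subset_itv_oo_cc.
  have hc : {within `[0, h], continuous (fun s : R => u (s *: e_ i + x) : R)}.
    by apply: continuous_in_subspaceT => t /set_mem tI; apply: cont; exact: ab.
  have [c cI] := MVT_segment h0 hd hc.
  by rewrite scale0r add0r subr0 mulrC => ->; exists c => //; exact: ab.
- have ab t : t \in `[h, 0]%R -> `|t| <= `|h|.
    rewrite in_itv/= => /andP[t0 th]; rewrite !ler0_norm ?lerN2 //; exact: ltW.
  have hd t : t \in `]h, 0[%R ->
      is_derive t 1 (fun s : R => u (s *: e_ i + x)) (pderiv u i (t *: e_ i + x)).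
    by move=> tI; apply: is_derive_line; apply: du; apply: ab; exact: subset_itv_oo_cc.
  have hc : {within `[h, 0], continuous (fun s : R => u (s *: e_ i + x) : R)}.
    by apply: continuous_in_subspaceT => t /set_mem tI; apply: cont; exact: ab.
  have [c cI] := MVT_segment (ltW h0) hd hc.
  rewrite scale0r add0r sub0r mulrN => hE; exists c; first exact: ab.
  by rewrite -opprB hE opprK mulrC.
Qed.

Lemma coord_ler_norm x i : `|x 0 i| <= `|x|.
Proof. 
rewrite [leRHS]/Num.norm /= mx_normrE.
by rewrite (bigmaxD1 (0, i))//= le_max lexx.
Qed.

Lemma rV_norm_ler x (r : R) : 0 <= r -> (forall i, `|x 0 i| <= r) -> `|x| <= r.
Proof.
move=> r0 xr; rewrite [leLHS]/Num.norm /= mx_normrE.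
by apply: bigmax_le => // -[i j] _ /=; rewrite ord1.
Qed.

Lemma rV_nbhs_ball x (A : set 'rV[R]_d) : nbhs x A ->
  exists2 r : R, 0 < r & forall y, `|y - x| <= r -> A y.
Proof.
move=> /nbhs_ballP[r /= r0 rA]; exists (r / 2); first by rewrite divr_gt0.
move=> y yx; apply: rA; rewrite -ball_normE /= distrC.
by apply: le_lt_trans yx _; rewrite gtr_pMr ?invf_lt1 ?ltr1n.
Qed.

(* The path from x to y changes the coordinates one at a time. *)
Lemma C1_caratheodory W u x : open W -> W x -> Ck 1 W u ->
  exists2 G : 'I_d -> 'rV[R]_d -> R,
    forall i, G i @ x --> pderiv u i x &
    \forall y \near x, u y - u x = \sum_i (y - x) 0 i * G i y.
Proof.
move=> oW Wx cu.
have [r r0 rW] := rV_nbhs_ball (open_nbhs_nbhs (conj oW Wx)).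
pose corner y k : 'rV[R]_d := \row_i (if (i < k)%N then y 0 i else x 0 i).
have step y (i : 'I_d) : corner y i.+1 = (y - x) 0 i *: e_ i + corner y i.
  apply/rowP => j; rewrite !mxE eqxx /= ltnS leq_eqVlt.
  have [->|ji] := eqVneq j i; first by rewrite eqxx ltnn /= mulr1 subrK.
  by rewrite (negbTE (ji : (j : nat) != i)) /= mulr0 add0r.
have near_corner y (i : 'I_d) t : `|t| <= `|(y - x) 0 i| ->
    `|t *: e_ i + corner y i - x| <= `|y - x|.
  move=> ht; apply: rV_norm_ler => // j; rewrite !mxE eqxx /=.
  have [->|ji] := eqVneq j i.
    by rewrite mulr1 ltnn addrK (le_trans ht)// coord_ler_norm.
  rewrite mulr0 add0r; case: ifP => _; last by rewrite subrr normr0.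
  by have := coord_ler_norm (y - x) j; rewrite !mxE.
have key (i : 'I_d) : exists c : 'rV[R]_d -> 'rV[R]_d, forall y, `|y - x| <= r ->
   `|c y - x| <= `|y - x| /\
    u (corner y i.+1) - u (corner y i) = (y - x) 0 i * pderiv u i (c y).
  suff /choice[c cP] : forall y, exists z : 'rV[R]_d, `|y - x| <= r ->
      `|z - x| <= `|y - x| /\
      u (corner y i.+1) - u (corner y i) = (y - x) 0 i * pderiv u i z by exists c.
  move=> y.
  have [yr|] := boolP (`|y - x| <= r); last by exists x.
  have [|t ht E] := @pderiv_MVT u i (corner y i) ((y - x) 0 i).
    move=> t ht.
    exact: (Ck_derivable i cu (rW _ (le_trans (near_corner _ _ _ ht) yr))).
  by exists (t *: e_ i + corner y i) => _; rewrite step E; split => //; exact: near_corner.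
have {}[c cP] := choice key.
have rx : \forall y \near x, `|y - x| <= r.
  apply: filterS (nbhsx_ballx x r r0) => y; rewrite -ball_normE /= distrC.
  exact: ltW.
exists (fun i y => pderiv u i (c i y)).
  move=> i.
  have pc : {for x, continuous (pderiv u i)}.
    exact: Ck_continuous (Ck_pderiv i cu) Wx.
  suff cx : c i @ x --> x by exact: (cvg_comp _ _ cx pc).
  move=> A /rV_nbhs_ball[e e0 eA].
  have ex : \forall y \near x, `|y - x| <= e.
    apply: filterS (nbhsx_ballx x e e0) => y; rewrite -ball_normE /= distrC.
    exact: ltW.
  apply: filterS (filterI rx ex) => y [yr ye]; apply: eA.
  by apply: le_trans ye; exact: (cP i y yr).1.
apply: filterS rx => y yr.
transitivity (u (corner y d) - u (corner y 0%N)).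
  congr (u _ - u _); apply/rowP => j; rewrite !mxE ?ltn_ord //.
rewrite -(@telescope_sumr _ 0%N d (fun k => u (corner y k))) // big_mkord.
by apply: eq_bigr => i _; exact: (cP i y yr).2.
Qed.

End StrictDifferentiability.

Section Schwarz.
Context {R : realType} {d : nat}.
Implicit Types (u v : 'rV[R]_d -> R) (x y z : 'rV[R]_d) (W : set 'rV[R]_d).
Local Notation e_ i := (delta_mx 0 i : 'rV[R]_d).

Lemma growth_rate_shift u (a x e : 'rV[R]_d) :
  (fun h : R => h^-1 *: (((fun y => u (a + y)) \o shift x) (h *: e) - u (a + x))) =
  (fun h : R => h^-1 *: ((u \o shift (a + x)) (h *: e) - u (a + x))).
Proof. by apply/funext => h /=; rewrite addrCA. Qed.

Lemma derivable_translate u a x e :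
  derivable u (a + x) e -> derivable (fun y => u (a + y)) x e.
Proof. by rewrite /derivable growth_rate_shift. Qed.

Lemma pderiv_translate u a i x :
  pderiv (fun y => u (a + y)) i x = pderiv u i (a + x).
Proof. by rewrite /pderiv /derive growth_rate_shift. Qed.

Lemma delta_norm i (h : R) : `|h *: e_ i| <= `|h|.
Proof.
apply: rV_norm_ler => // j; rewrite !mxE eqxx /= normrM ler_piMr//.
by case: (j == i); rewrite ?normr1 ?normr0.
Qed.

(** The mean value theorem is used twice: on y -> u (h e_j + y) - u y in direction i, then on the
    i-th partial derivative in direction j. The left-hand side does not change when i and j are
    exchanged. *)
Lemma second_difference W u x i j (h : R) : Ck 2 W u ->
  (forall y, `|y - x| <= `|h| + `|h| -> W y) ->
  exists2 z, `|z - x| <= `|h| + `|h| &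
   u (h *: e_ i + (h *: e_ j + x)) - u (h *: e_ j + x) - u (h *: e_ i + x) + u x =
   h * (h * pderiv (pderiv u i) j z).
Proof.
move=> cu hW.
have inW (s t : R) k l : `|s| <= `|h| -> `|t| <= `|h| ->
    `|s *: e_ k + (t *: e_ l + x) - x| <= `|h| + `|h|.
  move=> sh th; rewrite addrA addrK; apply: le_trans (ler_normD _ _) _.
  by apply: lerD; [apply: le_trans sh|apply: le_trans th]; exact: delta_norm.
have inW0 (s : R) k : `|s| <= `|h| -> W (s *: e_ k + x).
  move=> sh; have := inW s 0 k k sh; rewrite normr0 scale0r add0r => /(_ (normr_ge0 _)).
  exact: hW.
have dshift (s : R) : `|s| <= `|h| ->
    derivable (fun y => u (h *: e_ j + y)) (s *: e_ i + x) (e_ i).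
  move=> sh; apply: derivable_translate.
  exact: (Ck_derivable i (CkS cu) (hW _ (inW _ _ _ _ (lexx _) sh))).
have d0 (s : R) : `|s| <= `|h| -> derivable u (s *: e_ i + x) (e_ i).
  by move=> sh; exact: (Ck_derivable i (CkS cu) (inW0 _ _ sh)).
have [|s sh E] := @pderiv_MVT R d (fun y => u (h *: e_ j + y) - u y) i x h.
  by move=> s sh; exact: (derivableB (dshift _ sh) (d0 _ sh)).
have [|t th E'] := @pderiv_MVT R d (pderiv u i) j (s *: e_ i + x) h.
  move=> t th.
  exact: (Ck_derivable j (Ck_pderiv i cu) (hW _ (inW _ _ _ _ th sh))).
exists (t *: e_ j + (s *: e_ i + x)); first exact: inW.
rewrite -E' -pderiv_translate.
have <- : pderiv (fun y => u (h *: e_ j + y) - u y) i (s *: e_ i + x) =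
    pderiv (fun y => u (h *: e_ j + y)) i (s *: e_ i + x) - pderiv u i (s *: e_ i + x).
  exact: deriveB (dshift _ sh) (d0 _ sh).
rewrite -E [h *: e_ j + (h *: e_ i + x)]addrCA.
ring.
Qed.

(** One second difference gives both mixed derivatives, at two points z and z' near x. Dividing by h
    twice equates these values, and continuity of both derivatives at x concludes. *)
Lemma pderivC W u x i j : open W -> W x -> Ck 2 W u ->
  pderiv (pderiv u i) j x = pderiv (pderiv u j) i x.
Proof.
move=> oW Wx cu.
have swap (A A' b c e : R) : A = A' -> A - b - c + e = A' - c - b + e.
  by move=> ->; ring.
have close (p q s e : R) : `|p - s| <= e / 2 -> `|q - s| <= e / 2 -> `|p - q| <= e.
  move=> ps qs; rewrite [leRHS]splitr -(subrK s p) -addrA.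
  by rewrite (le_trans (ler_normD _ _))// lerD// distrC.
pose a := pderiv (pderiv u i) j; pose b := pderiv (pderiv u j) i.
have ca : {for x, continuous a} := Ck_continuous (Ck_pderiv j (Ck_pderiv i cu)) Wx.
have cb : {for x, continuous b} := Ck_continuous (Ck_pderiv i (Ck_pderiv j cu)) Wx.
apply/eqP; rewrite -subr_eq0 -normr_le0; apply/ler_addgt0Pl => e e0; rewrite addr0.
have e2 : 0 < e / 2 by rewrite divr_gt0.
have na : \forall y \near x, `|a x - a y| <= e / 2 by exact: cvgr_dist_le ca _ e2.
have nb : \forall y \near x, `|b x - b y| <= e / 2 by exact: cvgr_dist_le cb _ e2.
have [r r0 rP] := rV_nbhs_ball (filterI (open_nbhs_nbhs (conj oW Wx)) (filterI na nb)).
pose h := r / 2.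
have hh : `|h| + `|h| = r by rewrite ger0_norm ?divr_ge0 ?ltW// -splitr.
have hW y : `|y - x| <= `|h| + `|h| -> W y by rewrite hh => /rP[].
have h0 : h != 0 by rewrite mulf_neq0 ?gt_eqF// invr_gt0.
have [z zx Ez] := second_difference i j cu hW.
have [z' zx' Ez'] := second_difference j i cu hW.
have ab : a z = b z'.
  apply: (mulfI h0); apply: (mulfI h0).
  exact: (etrans (esym Ez) (etrans (swap _ _ _ _ _ (congr1 u (addrCA _ _ _))) Ez')).
rewrite hh in zx zx'; have [_ [za _]] := rP _ zx; have [_ [_ zb]] := rP _ zx'.
by apply: close za _; rewrite ab.
Qed.

End Schwarz.

Lemma mx_cvg (T U : topologicalType) m n (F : set_system T) (w : T -> 'M[U]_(m, n))
    (l : 'M[U]_(m, n)) : Filter F ->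
  (forall i j, (fun t => w t i j) @ F --> l i j) -> w @ F --> l.
Proof.
move=> FF wl A [P lP PA]; rewrite /=.
suff : \forall t \near F, forall i j, P i j (w t i j) by apply: filterS => t /PA.
apply: filter_forall => i; apply: filter_forall => j; exact: wl (lP i j).
Qed.

Section ChainRule.
Context {R : realType} {d n : nat}.
Implicit Types (u v : 'rV[R]_n -> R) (x y : 'rV[R]_d) (V : set 'rV[R]_n)
  (W : set 'rV[R]_d) (w : 'rV[R]_d -> 'rV[R]_n).

(** The slopes of [C1_caratheodory] turn the difference quotient of u \o w into a sum of products of
    convergent factors, with no special case when w does not move. Only derivability of w along e is
    needed. *)
Lemma is_derive_comp V u w x e : open V -> V (w x) -> Ck 1 V u ->
  (forall j, derivable (fun y => w y 0 j) x e) ->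
  is_derive x e (u \o w) (\sum_j pderiv u j (w x) * 'D_e (fun y => w y 0 j) x).
Proof.
move=> oV Vw cu dw.
have [G Glim GE] := C1_caratheodory oV Vw cu.
have wline : (fun h : R => w (h *: e + x)) @ 0^' --> w x.
  apply: mx_cvg => i j; rewrite ord1.
  have dj : derivable (fun y => w y 0 j) (0 *: e + x) e by rewrite scale0r add0r; exact: dw.
  have [dl _] := is_derive_line dj.
  have /continuous_withinNx : {for 0, continuous (fun s : R => w (s *: e + x) 0 j : R)}.
    by apply: differentiable_continuous; apply/derivable1_diffP.
  by rewrite scale0r add0r.
have dq j : h^-1 *: (((fun y => w y 0 j) \o shift x) (h *: e) - w x 0 j) @[h --> 0^'] -->
    'D_e (fun y => w y 0 j) x by exact: dw.
have lim : h^-1 *: (((u \o w) \o shift x) (h *: e) - (u \o w) x) @[h --> 0^'] -->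
    \sum_j pderiv u j (w x) * 'D_e (fun y => w y 0 j) x.
  have : (fun h : R => \sum_j G j (w (h *: e + x)) *
      (h^-1 *: (((fun y => w y 0 j) \o shift x) (h *: e) - w x 0 j))) @ 0^' -->
    \sum_j pderiv u j (w x) * 'D_e (fun y => w y 0 j) x.
    apply: cvg_big => [|j _]; first exact: add_continuous.
    apply: cvgM; last exact: dq.
    exact: (cvg_comp _ _ wline (Glim j)).
  move=> lim; refine (cvg_trans (near_eq_cvg _) lim).
  have GEh : \forall h \near (0 : R)^', u (w (h *: e + x)) - u (w x) =
      \sum_j (w (h *: e + x) - w x) 0 j * G j (w (h *: e + x)) := wline _ GE.
  apply: filterS GEh => h /= ->.
  rewrite scaler_sumr; apply: eq_bigr => j _; rewrite /GRing.scale /= !mxE.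
  by rewrite mulrCA; congr (_ * _); rewrite mulrC.
by split; [apply/cvg_ex; eexists; exact: lim|exact: cvg_lim lim].
Qed.

Lemma pderiv_comp V u w x i : open V -> V (w x) -> Ck 1 V u ->
  (forall j, derivable (fun y => w y 0 j) x (delta_mx 0 i)) ->
  pderiv (u \o w) i x = \sum_j pderiv u j (w x) * pderiv (fun y => w y 0 j) i x.
Proof. by move=> oV Vw cu dw; have [_] := is_derive_comp oV Vw cu dw. Qed.

Lemma Ck_comp k V W u w : open V -> open W -> (forall x, W x -> V (w x)) ->
  Ck k V u -> (forall j, Ck k W (fun x => w x 0 j)) -> Ck k W (u \o w).
Proof.
move=> oV oW wV cu cw.
have wc x : W x -> w @ x --> w x.
  move=> Wx; apply: (@mx_cvg _ _ _ _ (nbhs x) w (w x)) => i j.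
  by rewrite ord1; exact: Ck_continuous (cw j) Wx.
have cont k' v x : Ck k' V v -> W x -> {for x, continuous (v \o w)}.
  by move=> cv Wx; exact: (cvg_comp _ _ (wc _ Wx) (Ck_continuous cv (wV _ Wx))).
clear wc; elim: k u cu cw => [|k IH] u cu cw.
  by split => // x Wx; exact: cont cu Wx.
split; first by move=> x Wx; exact: cont cu Wx.
have c1 k' (U : set 'rV[R]_n) v : Ck k'.+1 U v -> Ck 1 U v.
  by elim: k' v => // k' IHk v cv; apply: IHk; exact: CkS.
move=> i; split => [x Wx|].
  have dw j : derivable (fun y => w y 0 j) x (delta_mx 0 i).
    exact: (Ck_derivable i (cw j) Wx).
  by have [] := is_derive_comp oV (wV _ Wx) (c1 _ _ _ cu) dw.
have cs : Ck k W (fun x => \sum_j pderiv u j (w x) * pderiv (fun y => w y 0 j) i x).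
  apply: Ck_sum => // j; apply: CkM => //; last exact: Ck_pderiv (cw j).
  by apply: (IH _ (Ck_pderiv j cu)) => l; exact: CkS (cw l).
apply: Ck_congr cs => // x Wx; rewrite (pderiv_comp oV (wV _ Wx) (c1 _ _ _ cu)) //.
by move=> j; exact: (Ck_derivable i (cw j) Wx).
Qed.

End ChainRule.

Section ComplexSmooth.
Context {R : realType} {d : nat}.
Local Notation C := R[i].
Implicit Types (f g : 'rV[R]_d -> C) (x y : 'rV[R]_d) (W : set 'rV[R]_d).

Definition csmooth W f : Prop :=
  smooth_on W (fun x => complex.Re (f x)) /\ smooth_on W (fun x => complex.Im (f x)).

Definition cpderiv f (i : 'I_d) x : C :=
  Complex (pderiv (fun y => complex.Re (f y)) i x)
          (pderiv (fun y => complex.Im (f y)) i x).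

Lemma cReD (a b : C) : complex.Re (a + b) = complex.Re a + complex.Re b.
Proof. by case: a; case: b. Qed.
Lemma cImD (a b : C) : complex.Im (a + b) = complex.Im a + complex.Im b.
Proof. by case: a; case: b. Qed.
Lemma cReM (a b : C) :
  complex.Re (a * b) = complex.Re a * complex.Re b - complex.Im a * complex.Im b.
Proof. by case: a; case: b. Qed.
Lemma cImM (a b : C) :
  complex.Im (a * b) = complex.Re a * complex.Im b + complex.Im a * complex.Re b.
Proof. by case: a; case: b. Qed.
Lemma cReN (a : C) : complex.Re (- a) = - complex.Re a. Proof. by case: a. Qed.
Lemma cImN (a : C) : complex.Im (- a) = - complex.Im a. Proof. by case: a. Qed.
Lemma cReJ (a : C) : complex.Re (a^*)%R = complex.Re a. Proof. by case: a. Qed.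
Lemma cImJ (a : C) : complex.Im (a^*)%R = - complex.Im a. Proof. by case: a. Qed.
Lemma complexE (a b : C) : complex.Re a = complex.Re b ->
  complex.Im a = complex.Im b -> a = b.
Proof. by case: a => ? ?; case: b => ? ? /= -> ->. Qed.

Lemma cpderiv_congr W f g i x : open W -> (forall y, W y -> f y = g y) -> W x ->
  cpderiv f i x = cpderiv g i x.
Proof.
by move=> oW fg Wx; congr Complex; apply: (pderiv_congr i oW _ Wx) => y /fg ->.
Qed.

Lemma csmooth_subset W W' f : W' `<=` W -> csmooth W f -> csmooth W' f.
Proof. by move=> sW [fr fi]; split=> k; apply: Ck_subset sW _. Qed.

Lemma csmooth_cst W (c : C) : csmooth W (fun=> c).
Proof. by split=> k; exact: Ck_cst. Qed.

Lemma csmooth_pderiv W f i : csmooth W f -> csmooth W (cpderiv f i).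
Proof. by move=> [fr fi]; split=> k; [exact: Ck_pderiv (fr k.+1)|exact: Ck_pderiv (fi k.+1)]. Qed.

Lemma csmoothD W f g : open W -> csmooth W f -> csmooth W g ->
  csmooth W (fun x => f x + g x).
Proof.
move=> oW [fr fi] [gr gi]; split=> k.
  by under eq_fun do rewrite cReD; exact: CkD.
by under eq_fun do rewrite cImD; exact: CkD.
Qed.

Lemma csmoothM W f g : open W -> csmooth W f -> csmooth W g ->
  csmooth W (fun x => f x * g x).
Proof.
move=> oW [fr fi] [gr gi]; split=> k.
  by under eq_fun do rewrite cReM; apply: CkB => //; exact: CkM.
by under eq_fun do rewrite cImM; apply: CkD => //; exact: CkM.
Qed.

Lemma csmoothN W f : open W -> csmooth W f -> csmooth W (fun x => - f x).
Proof.
move=> oW [fr fi]; split=> k.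
  by under eq_fun do rewrite cReN; exact: CkN.
by under eq_fun do rewrite cImN; exact: CkN.
Qed.

Lemma csmoothJ W f : open W -> csmooth W f -> csmooth W (fun x => (f x)^*).
Proof.
move=> oW [fr fi]; split=> k.
  by under eq_fun do rewrite cReJ.
by under eq_fun do rewrite cImJ; exact: CkN.
Qed.

Lemma complex_normsq_neq0 (a : C) : a != 0 ->
  complex.Re a * complex.Re a + complex.Im a * complex.Im a != 0.
Proof.
by case: a => a b; rewrite eq_complex /= -!expr2 paddr_eq0 ?sqr_ge0 // !sqrf_eq0.
Qed.

Lemma csmoothV W f : open W -> (forall x, W x -> f x != 0) -> csmooth W f ->
  csmooth W (fun x => (f x)^-1).
Proof.
move=> oW f0 [fr fi].
pose n x := complex.Re (f x) * complex.Re (f x) + complex.Im (f x) * complex.Im (f x).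
have nV k : Ck k W (fun x => (n x)^-1).
  apply: CkV => // [x Wx|]; first exact/complex_normsq_neq0/f0.
  by apply: CkD => //; exact: CkM.
split=> k.
  apply: Ck_congr (CkM oW (fr k) (nV k)) => // x _.
  by rewrite /n; case: (f x) => a b /=; rewrite !expr2.
apply: Ck_congr (CkM oW (CkN oW (fi k)) (nV k)) => // x _.
by rewrite /n; case: (f x) => a b /=; rewrite !expr2 mulNr.
Qed.

Lemma csmooth_sum W (I : Type) (r : seq I) (P : pred I) (f_ : I -> 'rV[R]_d -> C) :
  open W -> (forall j, csmooth W (f_ j)) ->
  csmooth W (fun x => \sum_(j <- r | P j) f_ j x).
Proof.
move=> oW cf; elim: r => [|j r IH].
  by under eq_fun do rewrite big_nil; exact: csmooth_cst.
by under eq_fun do rewrite big_cons; case: (P j) => //; exact: csmoothD.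
Qed.

Lemma cpderiv_cst (c : C) i x : cpderiv (fun=> c) i x = 0.
Proof. by rewrite /cpderiv !pderiv_cst. Qed.

Lemma cpderivD W f g i x : csmooth W f -> csmooth W g -> W x ->
  cpderiv (fun y => f y + g y) i x = cpderiv f i x + cpderiv g i x.
Proof.
move=> [fr fi] [gr gi] Wx; rewrite /cpderiv.
under eq_fun do rewrite cReD; under [in X in Complex _ X]eq_fun do rewrite cImD.
rewrite pderivD; [|exact: (Ck_derivable i (fr 1) Wx)|exact: (Ck_derivable i (gr 1) Wx)].
by rewrite pderivD; [|exact: (Ck_derivable i (fi 1) Wx)|exact: (Ck_derivable i (gi 1) Wx)].
Qed.

Lemma cpderivM W f g i x : csmooth W f -> csmooth W g -> W x ->
  cpderiv (fun y => f y * g y) i x = cpderiv f i x * g x + f x * cpderiv g i x.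
Proof.
move=> [fr fi] [gr gi] Wx; rewrite /cpderiv.
have dfr := Ck_derivable i (fr 1) Wx; have dfi := Ck_derivable i (fi 1) Wx.
have dgr := Ck_derivable i (gr 1) Wx; have dgi := Ck_derivable i (gi 1) Wx.
under eq_fun do rewrite cReM; under [in X in Complex _ X]eq_fun do rewrite cImM.
have E1 : pderiv (fun y => complex.Re (f y) * complex.Re (g y) -
    complex.Im (f y) * complex.Im (g y)) i x =
    pderiv (fun y => complex.Re (f y) * complex.Re (g y)) i x -
    pderiv (fun y => complex.Im (f y) * complex.Im (g y)) i x.
  exact: deriveB (derivableM dfr dgr) (derivableM dfi dgi).
have E2 : pderiv (fun y => complex.Re (f y) * complex.Im (g y) +
    complex.Im (f y) * complex.Re (g y)) i x =
    pderiv (fun y => complex.Re (f y) * complex.Im (g y)) i x +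
    pderiv (fun y => complex.Im (f y) * complex.Re (g y)) i x.
  exact: deriveD (derivableM dfr dgi) (derivableM dfi dgr).
rewrite E1 E2 !pderivM //.
by apply: complexE; rewrite ?(cReD, cReM, cImD, cImM) /=; ring.
Qed.

Lemma cpderivN W f i x : csmooth W f -> W x ->
  cpderiv (fun y => - f y) i x = - cpderiv f i x.
Proof.
move=> sf Wx; have := cpderivM i (csmooth_cst W (-1)) sf Wx.
by rewrite cpderiv_cst mul0r add0r; under eq_fun do rewrite mulN1r; rewrite mulN1r.
Qed.

Lemma cpderivJ W f i x : csmooth W f -> W x ->
  cpderiv (fun y => (f y)^*) i x = (cpderiv f i x)^*.
Proof.
move=> [fr fi] Wx; rewrite /cpderiv; apply: complexE => /=.
  by congr (pderiv _ i x); apply/funext => y; rewrite cReJ.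
under eq_fun do rewrite cImJ.
exact: deriveN (Ck_derivable i (fi 1) Wx).
Qed.

Lemma cpderivV W f i x : open W -> (forall y, W y -> f y != 0) -> csmooth W f ->
  W x -> cpderiv (fun y => (f y)^-1) i x = - (f x)^-2 * cpderiv f i x.
Proof.
move=> oW f0 sf Wx; have sV := csmoothV oW f0 sf.
(* Differentiate f * f^-1, which equals 1 on W, and solve for the derivative of the inverse. *)
have := cpderivM i sf sV Wx.
rewrite (@cpderiv_congr W _ (fun=> 1) i x oW) //; last by move=> y /f0/mulfV.
rewrite cpderiv_cst => /esym/eqP; rewrite addrC addr_eq0 => /eqP E.
by apply: (mulfI (f0 _ Wx)); rewrite E; field; exact: f0.
Qed.

Lemma cpderiv_sum W (I : Type) (r : seq I) (P : pred I) (f_ : I -> 'rV[R]_d -> C) i x :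
  open W -> (forall j, csmooth W (f_ j)) -> W x ->
  cpderiv (fun y => \sum_(j <- r | P j) f_ j y) i x =
  \sum_(j <- r | P j) cpderiv (f_ j) i x.
Proof.
move=> oW cf Wx; elim: r => [|j r IH].
  by under eq_fun do rewrite big_nil; rewrite big_nil cpderiv_cst.
under eq_fun do rewrite big_cons; rewrite big_cons; case: (P j) => //.
by rewrite (@cpderivD W) ?IH//; exact: csmooth_sum.
Qed.

Lemma cpderivC W f x i j : open W -> W x -> csmooth W f ->
  cpderiv (cpderiv f i) j x = cpderiv (cpderiv f j) i x.
Proof.
move=> oW Wx [fr fi].
exact: (f_equal2 (@Complex R) (pderivC i j oW Wx (fr 2)) (pderivC i j oW Wx (fi 2))).
Qed.

End ComplexSmooth.

(** * Left-invariant vector fields on polynomials in the matrix entries *)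

Section InvariantFields.
Import -(notations) mpoly.
Context {K : comNzRingType} {k : nat}.
Implicit Types (F G : mpoly (k * k) K) (a b c e : 'I_k).

Definition coord_poly a b : mpoly (k * k) K := mpolyX K (mnm1 (mxvec_index a b)).

(** Infinitesimal right multiplication: the t-derivative at 0 of F (z (1 + t E_ab)), E_ab being the
    elementary matrix. *)
Definition lfield a b F : mpoly (k * k) K :=
  \sum_c coord_poly c a * mderiv (mxvec_index c b) F.

Lemma lfieldD a b F G : lfield a b (F + G) = lfield a b F + lfield a b G.
Proof. by rewrite -big_split; apply: eq_bigr => c _; rewrite mderivD mulrDr. Qed.

Lemma lfieldN a b F : lfield a b (- F) = - lfield a b F.
Proof. by rewrite -sumrN; apply: eq_bigr => c _; rewrite mderivN mulrN. Qed.

Lemma lfieldZ a b (x : K) F : lfield a b (x *: F) = x *: lfield a b F.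
Proof. by rewrite scaler_sumr; apply: eq_bigr => c _; rewrite mderivZ scalerAr. Qed.

Lemma lfieldM a b F G : lfield a b (F * G) = lfield a b F * G + F * lfield a b G.
Proof.
rewrite mulr_suml mulr_sumr -big_split; apply: eq_bigr => c _ /=.
by rewrite mderivM mulrDr !mulrA [F * coord_poly c a]mulrC.
Qed.

Lemma lfieldC a b (x : K) : lfield a b (mpolyC _ x) = 0.
Proof. by rewrite /lfield big1 // => c _; rewrite mderivC mulr0. Qed.

Lemma lfield_sum a b (I : Type) (r : seq I) (P : pred I) (F_ : I -> mpoly (k * k) K) :
  lfield a b (\sum_(i <- r | P i) F_ i) = \sum_(i <- r | P i) lfield a b (F_ i).
Proof.
elim: r => [|i r IH]; first by rewrite !big_nil /lfield big1 // => c _; rewrite mderiv0 mulr0.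
by rewrite !big_cons; case: (P i) => //; rewrite lfieldD IH.
Qed.

Lemma mxvec_index_eq a b c e :
  (mxvec_index a b == mxvec_index c e) = (a == c) && (b == e).
Proof.
apply/eqP/andP => [|[/eqP-> /eqP->]] //.
move/(congr1 (fun i => enum_val (cast_ord (esym (mxvec_cast k k)) i))).
by rewrite !cast_ordK !enum_rankK => -[-> ->].
Qed.

Lemma mderiv_coord a b c e :
  mderiv (mxvec_index c e) (coord_poly a b) = ((a == c) && (b == e))%:R.
Proof.
rewrite /coord_poly mderivX mnm1E mxvec_index_eq.
case: (boolP (_ && _)) => [/andP[/eqP-> /eqP->]|_]; last by rewrite scale0r.
rewrite scale1r -mpolyX0; congr (mpolyX _ _).
by apply/mnmP => i; rewrite mnmBE mnm0E subnn.
Qed.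

Lemma lfield_coord a b c e :
  lfield a b (coord_poly c e) = (e == b)%:R * coord_poly c a.
Proof.
rewrite /lfield (bigD1 c) //= mderiv_coord eqxx /= big1 ?addr0 1?mulrC // => i ic.
by rewrite mderiv_coord [c == i]eq_sym (negbTE ic) mulr0.
Qed.

(** The structure relations of gl_k. Each composite has a second-order part, symmetric in the two
    fields because partial derivatives commute, and a first-order part from differentiating the
    coefficient; only the latter survives in the commutator. *)
Lemma lfield_comm a b c e F :
  lfield c e (lfield a b F) - lfield a b (lfield c e F) =
  (e == a)%:R * lfield c b F - (b == c)%:R * lfield a e F.
Proof.
have E a' b' c' e' : lfield c' e' (lfield a' b' F) = (e' == a')%:R * lfield c' b' F +
    \sum_i \sum_j coord_poly i c' * coord_poly j a' *
      mderiv (mxvec_index i e') (mderiv (mxvec_index j b') F).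
  transitivity (\sum_j lfield c' e' (coord_poly j a' * mderiv (mxvec_index j b') F)).
    exact: lfield_sum.
  rewrite [X in _ = _ + X]exchange_big /= [lfield c' b' F]/lfield mulr_sumr -big_split.
  apply: eq_bigr => j _ /=; rewrite lfieldM lfield_coord [a' == e']eq_sym mulrA; congr (_ + _).
  by rewrite mulr_sumr; apply: eq_bigr => i _; rewrite mulrA [coord_poly i _ * _]mulrC.
rewrite E (E c e a b) exchange_big /= opprD addrACA.
rewrite [X in _ + X = _](_ : _ = 0) ?addr0 //; apply/eqP; rewrite subr_eq0; apply/eqP.
apply: eq_bigr => i _; apply: eq_bigr => j _.
by rewrite [coord_poly j _ * _]mulrC mderiv_comm.
Qed.

(* The numerator of the derivative of F / G along lfield a b. *)
Definition wronskian F G a b := lfield a b F * G - F * lfield a b G.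

Lemma wronskian_eigen (x : K) F G a b : lfield a b F = x *: F ->
  lfield a b G = x *: G -> wronskian F G a b = 0.
Proof. by rewrite /wronskian => -> ->; rewrite -scalerAl -scalerAr subrr. Qed.

(** Commuting L_ce past L_ab yields the eigenvalue and a bracket. The eigenvalue counts twice
    because the Wronskian is bilinear in F and G. *)
Lemma lfield_wronskian (x : K) F G a b c e : lfield c e F = x *: F ->
  lfield c e G = x *: G ->
  lfield c e (wronskian F G a b) = (x *+ 2) *: wronskian F G a b +
    ((e == a)%:R * wronskian F G c b - (b == c)%:R * wronskian F G a e).
Proof.
move=> xF xG.
have bracket H : lfield c e H = x *: H -> lfield c e (lfield a b H) =
    x *: lfield a b H +
    ((e == a)%:R * lfield c b H - (b == c)%:R * lfield a e H).
  by move=> xH; rewrite -lfield_comm xH lfieldZ addrC subrK.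
rewrite /wronskian lfieldD lfieldN !lfieldM (bracket _ xF) (bracket _ xG) xF xG.
rewrite -!mul_mpolyC rmorphMn /=.
move: (lfield a b F) (lfield a b G) (lfield c b F) (lfield c b G) (lfield a e F)
  (lfield a e G) (mpolyC _ _) => A1 A2 A3 A4 A5 A6 A7.
by ring.
Qed.

(** Weights add under products: [Q F n] says that F has weight n times x. *)
Lemma lfield_prod_eigen a b (x : K) (I : Type) (r : seq I) (h : I -> mpoly (k * k) K)
    (e_ : I -> nat) : (forall i, lfield a b (h i) = x *: h i) ->
  lfield a b (\prod_(i <- r) h i ^+ e_ i) =
  ((\sum_(i <- r) e_ i)%:R * x) *: \prod_(i <- r) h i ^+ e_ i.
Proof.
move=> hE; pose Q F n := lfield a b F = (n%:R * x) *: F.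
have QM F G i j : Q F i -> Q G j -> Q (F * G) (i + j)%N.
  rewrite /Q => QF QG; rewrite lfieldM QF QG -scalerAl -scalerAr -scalerDl.
  by rewrite natrD mulrDl.
have Q1 : Q 1 0%N by rewrite /Q mul0r scale0r -(lfieldC a b 1).
have QX i n : Q (h i ^+ n) n.
  elim: n => [|n IH] //; rewrite exprS -add1n; apply: QM => //.
  by rewrite /Q mul1r hE.
by apply: (big_rec2 (fun F n => Q F n)) => // i n F _; exact: QM.
Qed.

(* Euler's relation, for the Euler field multiplied by x. *)
Lemma lfield_comp_eigen a b (x : K) N d (h : N.-tuple (mpoly (k * k) K))
    (P : mpoly N K) : P \is ishomog1 d mdeg ->
  (forall i, lfield a b (tnth h i) = x *: tnth h i) ->
  lfield a b (comp_mpoly h P) = (d%:R * x) *: comp_mpoly h P.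
Proof.
move=> /dhomogP Pd hE; rewrite comp_mpolyEX lfield_sum scaler_sumr.
rewrite big_seq [RHS]big_seq; apply: eq_bigr => w /Pd wd.
have {wd}<- : mdeg w = d by exact: wd.
by rewrite mdegE lfieldZ comp_mpolyX (lfield_prod_eigen _ _ hE) !scalerA mulrC.
Qed.

(** Jacobi's formula for a derivation: differentiate one row at a time and expand along that row,
    whose cofactors do not see the change. *)
Lemma lfield_det a b r (M : 'M[mpoly (k * k) K]_r) :
  lfield a b (\det M) = \sum_i \sum_j lfield a b (M i j) * cofactor M i j.
Proof.
have lprod (s : seq 'I_r) (f : 'I_r -> mpoly (k * k) K) : uniq s ->
    lfield a b (\prod_(i <- s) f i) =
    \sum_(i <- s) lfield a b (f i) * \prod_(j <- s | j != i) f j.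
  elim: s => [|i s IH] /=; first by rewrite !big_nil -mpolyC1 lfieldC.
  move=> /andP[is_ us]; rewrite !big_cons lfieldM IH // eqxx /=; congr (_ * _ + _).
    rewrite big_seq [RHS]big_seq_cond; apply: eq_big => // j.
    case: eqVneq => [->|]; last by rewrite andbT.
    by rewrite (negbTE is_).
  rewrite mulr_sumr big_seq [RHS]big_seq; apply: eq_bigr => j js.
  have ij : i != j by apply: contraNneq is_ => ->.
  by rewrite big_cons ij; exact: mulrCA.
pose M' i := \matrix_(p, q) if p == i then lfield a b (M p q) else M p q.
have -> : lfield a b (\det M) = \sum_i \det (M' i).
  rewrite /determinant lfield_sum [RHS]exchange_big; apply: eq_bigr => s _ /=.
  have -> : (-1) ^+ s = mpolyC (k * k) ((-1) ^+ s : K).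
    by rewrite rmorphXn /= rmorphN rmorph1.
  rewrite -mulr_sumr lfieldM lfieldC mul0r add0r lprod ?index_enum_uniq //; congr (_ * _).
  apply: eq_bigr => i _; rewrite [RHS](bigD1 i) //= !mxE eqxx; congr (_ * _).
  by apply: eq_bigr => j ji; rewrite mxE (negbTE ji).
apply: eq_bigr => i _; rewrite (expand_det_row _ i); apply: eq_bigr => j _.
rewrite mxE eqxx; congr (_ * _); rewrite /cofactor; congr (_ * \det _).
by apply/matrixP => p q; rewrite !mxE eq_sym (negbTE (neq_lift _ _)).
Qed.

End InvariantFields.

Section MatrixEvaluation.
Import -(notations) mpoly.
Context {K : comNzRingType} {k : nat}.

Definition mxeval (Z : 'M[K]_k) (F : mpoly (k * k) K) : K :=
  meval (fun l => mxvec Z 0 l) F.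

HB.instance Definition _ Z :=
  GRing.RMorphism.copy (mxeval Z) (meval (fun l => mxvec Z 0 l)).

Lemma mxeval_coord Z a b : mxeval Z (coord_poly a b) = Z a b.
Proof. by rewrite /mxeval mevalXU mxvecE. Qed.

Lemma mxevalC Z (x : K) : mxeval Z (mpolyC _ x) = x.
Proof. exact: mevalC. Qed.

Lemma mxevalZ Z (x : K) F : mxeval Z (x *: F) = x * mxeval Z F.
Proof. exact: mevalZ. Qed.

(** Induction on the algebra generated by the matrix entries. Smoothness, continuity and the
    derivative formula of evaluations are all transferred from the entries through it. *)
Lemma mpoly_mxind (Q : mpoly (k * k) K -> Prop) :
  (forall x, Q (mpolyC _ x)) -> (forall a b, Q (coord_poly a b)) ->
  (forall F G, Q F -> Q G -> Q (F + G)) -> (forall F G, Q F -> Q G -> Q (F * G)) ->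
  forall F, Q F.
Proof.
move=> QC QX QD QM F; elim/mpolyind: F => [|c w F _ _ QF]; first by rewrite -mpolyC0.
apply: QD QF; rewrite -mul_mpolyC; apply: (QM) => //.
rewrite (mpolyXE_id K w); apply: (big_ind Q) => [||i _]; [by rewrite -mpolyC1|exact: QM|].
elim: (w i) => [|e IH]; first by rewrite expr0 -mpolyC1.
rewrite exprS; apply: (QM) IH; case/mxvec_indexP: i => a b; exact: QX.
Qed.

End MatrixEvaluation.

(** * Minors as polynomials, and their weights under the parabolic subalgebra *)

Section MinorPolynomials.
Import -(notations) mpoly.
Context {R : realType} {m n : nat}.
Local Notation C := R[i].
Local Notation k := (m + n)%N.
Implicit Types (a b c e : 'I_k) (P Q : mpoly (num_choices m n) C).

Definition gen_minor (r : row_choice m n) : mpoly (k * k) C :=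
  \det (\matrix_(i < m, j < m) coord_poly (tnth (val r) i) (lshift n j)).

Definition gen_poly P : mpoly (k * k) C :=
  comp_mpoly [tuple gen_minor (enum_val i) | i < num_choices m n] P.

(** Defined on all matrices: the density argument leaves the unitary group, by clearing a
    determinant along its path. *)
Definition mx_minor (Z : 'M[C]_k) (r : row_choice m n) : C :=
  \det (\matrix_(i < m, j < m) Z (tnth (val r) i) (lshift n j)).

Definition minor_poly P (Z : 'M[C]_k) : C :=
  meval (fun i : 'I_(num_choices m n) => mx_minor Z (enum_val i)) P.

Lemma mxeval_minor_poly P Z : mxeval Z (gen_poly P) = minor_poly P Z.
Proof.
rewrite /mxeval /gen_poly comp_mpoly_meval; apply: meval_eq => i.
rewrite tnth_mktuple /gen_minor /mx_minor -/(mxeval Z _) -det_map_mx.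
by congr (\det _); apply/matrixP => p q; rewrite !mxE; exact: mxeval_coord.
Qed.

Lemma mxeval_gen_poly P z : mxeval (umx z) (gen_poly P) = poly_phi P z.
Proof. exact: mxeval_minor_poly. Qed.

Lemma mx_minorZ (c : C) Z r : mx_minor (c *: Z) r = c ^+ m * mx_minor Z r.
Proof.
rewrite /mx_minor -detZ; congr (\det _).
by apply/matrixP => i j; rewrite !mxE.
Qed.

(** The first m columns of the product are the first m columns of Z multiplied by A. *)
Lemma mx_minor_block Z r (A : 'M[C]_m) (B : 'M[C]_n) :
  mx_minor (Z *m block_mx A 0 0 B) r = \det A * mx_minor Z r.
Proof.
rewrite /mx_minor mulrC -det_mulmx; congr (\det _).
apply/matrixP => i j; rewrite !mxE big_split_ord /= [X in _ + X]big1 ?addr0.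
  by apply: eq_bigr => l _; rewrite block_mxEul mxE.
by move=> l _; rewrite block_mxEdl mxE mulr0.
Qed.

(** Serves two kinds of factor: y = c ^+ m when the matrix is scaled by c, and y = \det A when it is
    multiplied on the right by a block-diagonal matrix. *)
Lemma minor_poly_eigen d P (y : C) Z Z' : homogeneous d P ->
  (forall r, mx_minor Z' r = y * mx_minor Z r) ->
  minor_poly P Z' = y ^+ d * minor_poly P Z.
Proof.
move=> /dhomogP Pd ZZ'; rewrite /minor_poly !mevalE mulr_sumr.
rewrite big_seq [RHS]big_seq; apply: eq_bigr => w /Pd wd.
have {wd}<- : mdeg w = d by exact: wd.
rewrite mdegE -prodrXr mulrCA -big_split /=; congr (_ * _).
by apply: eq_bigr => i _; rewrite ZZ' exprMn.
Qed.

(* The Lie algebra of the stabiliser of the span of the first m basis vectors. *)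
Definition parabolic a b := (m <= b)%N || (a < m)%N.

(** On elementary matrices, d times the trace of the upper left block: the infinitesimal character
    of \det A ^+ d. *)
Definition weight d a b : C := if (b < m)%N then d%:R * (a == b)%:R else 0.

(** L_ab replaces column b by column a. If m <= b the minor does not involve column b; otherwise a <
    m, and the result is the minor itself or has a repeated column. Through cofactors, this is the
    entry (b, a) of \adj N *m N. *)
Lemma lfield_minor a b r : parabolic a b ->
  lfield a b (gen_minor r) = (if (b < m)%N then (a == b)%:R else 0) *: gen_minor r.
Proof.
rewrite /parabolic leqNgt lfield_det.
under eq_bigr do under eq_bigr do rewrite mxE lfield_coord.
case: ltnP => /= [bm am|mb _]; last first.
  rewrite scale0r big1 // => i _; rewrite big1 // => j _.
  case: eqVneq => [jb|]; last by rewrite !mul0r.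
  by move: mb; rewrite -jb leqNgt /= ltn_ord.
have [{}a -> {am}] : exists a' : 'I_m, a = lshift n a'.
  by exists (Ordinal am); apply: val_inj.
have [{}b -> {bm}] : exists b' : 'I_m, b = lshift n b'.
  by exists (Ordinal bm); apply: val_inj.
pose N := \matrix_(i < m, j < m) (coord_poly (tnth (val r) i) (lshift n j) : mpoly (k * k) C).
have E : (\adj N *m N) b a = (\det N)%:M b a by rewrite mul_adj_mx.
move: E; rewrite !mxE -/(gen_minor r) => E.
transitivity (gen_minor r *+ (b == a)).
  rewrite -E; apply: eq_bigr => i _; rewrite (bigD1 b) //= eqxx mul1r big1 ?addr0.
    by rewrite !mxE mulrC.
  by move=> j jb; rewrite (inj_eq (@lshift_inj _ _)) (negbTE jb) !mul0r.
by rewrite (inj_eq (@lshift_inj _ _)) eq_sym scaler_nat.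
Qed.

Lemma lfield_gen_poly d P a b : homogeneous d P -> parabolic a b ->
  lfield a b (gen_poly P) = weight d a b *: gen_poly P.
Proof.
move=> hP pab; rewrite (lfield_comp_eigen (d := d)
  (x := if (b < m)%N then (a == b)%:R else 0)) //.
  by rewrite /weight; case: ifP => //; rewrite mulr0.
by move=> i; rewrite tnth_mktuple lfield_minor.
Qed.

End MinorPolynomials.

(** * The Laplace-Beltrami operator in coordinates *)

Section LaplaceBeltrami.
Context {R : realType} {d : nat}.
Implicit Types (u : 'rV[R]_d -> R) (x y : 'rV[R]_d) (W : set 'rV[R]_d).

Lemma Ck_prod k W (I : Type) (r : seq I) (u_ : I -> 'rV[R]_d -> R) :
  open W -> (forall j, Ck k W (u_ j)) -> Ck k W (fun x => \prod_(j <- r) u_ j x).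
Proof.
move=> oW cu; elim: r => [|j r IH].
  by apply: Ck_congr (Ck_cst k W 1) => // x _; rewrite big_nil.
by apply: Ck_congr (CkM oW (cu j) IH) => // x _; rewrite big_cons.
Qed.

Lemma Ck_det k W r (A : 'rV[R]_d -> 'M[R]_r) : open W ->
  (forall i j, Ck k W (fun x => A x i j)) -> Ck k W (fun x => \det (A x)).
Proof.
move=> oW cA; apply: Ck_sum => // s; apply: CkZ => //.
by apply: Ck_prod => // i; exact: cA.
Qed.

(** Cramer's rule. *)
Lemma Ck_invmx k W (A : 'rV[R]_d -> 'M[R]_d) : open W ->
  (forall i j, Ck k W (fun x => A x i j)) -> (forall x, W x -> A x \in unitmx) ->
  forall i j, Ck k W (fun x => invmx (A x) i j).
Proof.
move=> oW cA uA i j.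
have dA : forall x, W x -> \det (A x) != 0.
  by move=> x /uA; rewrite unitmxE unitfE.
have cV := CkV oW dA (Ck_det oW cA).
have cC : Ck k W (fun x => cofactor (A x) j i).
  apply: CkZ => //; apply: Ck_det => // p q.
  by apply: Ck_congr (cA (lift j p) (lift i q)) => // x _; rewrite !mxE.
apply: Ck_congr (CkM oW cV cC) => // x Wx.
by rewrite /invmx uA // !mxE.
Qed.

Context (W : set 'rV[R]_d) (g : 'rV[R]_d -> 'M[R]_d).
Hypothesis oW : open W.
Hypothesis cg : forall i j, Ck 1 W (fun y => g y i j).
Hypothesis ug : forall y, W y -> g y \in unitmx.
Hypothesis sg : forall y, W y -> (g y)^T = g y.

(** The Laplacian of the l-th coordinate function: the divergence of column l of the inverse
    metric. *)
Definition drift (l : 'I_d) x : R :=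
  \sum_i (pderiv (fun y => invmx (g y) i l) i x +
          \sum_k christoffel g i i k x * invmx (g x) k l).

Lemma laplace_beltramiE u x : W x -> Ck 2 W u ->
  laplace_beltrami g u x =
  \sum_i \sum_l invmx (g x) i l * pderiv (pderiv u l) i x +
  \sum_l drift l x * pderiv u l x.
Proof.
move=> Wx cu; rewrite /laplace_beltrami /divergence /gradient.
have dginv i l := Ck_derivable i (Ck_invmx oW cg ug i l) Wx.
have du i l := Ck_derivable i (Ck_pderiv l cu) Wx.
have dE i : pderiv (fun y => \sum_l invmx (g y) i l * pderiv u l y) i x =
    \sum_l (pderiv (fun y => invmx (g y) i l) i x * pderiv u l x +
            invmx (g x) i l * pderiv (pderiv u l) i x).
  rewrite pderiv_sum; last first.
    move=> l; exact: (derivableM (dginv i l) (du i l)).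
  by apply: eq_bigr => l _; rewrite (pderivM (dginv i l) (du i l)).
rewrite [X in _ = _ + X](_ : _ = \sum_i \sum_l
    (pderiv (fun y => invmx (g y) i l) i x +
      \sum_k christoffel g i i k x * invmx (g x) k l) * pderiv u l x); last first.
  by rewrite exchange_big; apply: eq_bigr => l _; rewrite mulr_suml.
rewrite -big_split /=; apply: eq_bigr => i _; rewrite dE big_split /= addrAC addrC.
congr (_ + _); under [RHS]eq_bigr do rewrite mulrDl; rewrite [RHS]big_split /=.
congr (_ + _); under eq_bigr do rewrite mulr_sumr; rewrite exchange_big.
by apply: eq_bigr => l _; rewrite mulr_suml; apply: eq_bigr => p _; rewrite mulrA.
Qed.

Lemma invmx_sym x : W x -> (invmx (g x))^T = invmx (g x).
Proof. by move=> Wx; rewrite trmx_inv sg. Qed.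

(** Lowering the index removes all derivatives of the inverse metric. Differentiating g^-1 g = 1
    moves them onto g, and in the contracted Christoffel symbol two of the three terms cancel by
    symmetry. *)
Lemma drift_metric x c : W x ->
  \sum_l drift l x * g x l c =
  - (\sum_i \sum_l invmx (g x) i l * pderiv (fun y => g y l c) i x) +
  2^-1 * \sum_i \sum_l invmx (g x) i l * pderiv (fun y => g y i l) c x.
Proof.
move=> Wx.
have dginv i l := Ck_derivable i (Ck_invmx oW cg ug i l) Wx.
have dg i l p := Ck_derivable i (cg l p) Wx.
have dinv i : \sum_l pderiv (fun y => invmx (g y) i l) i x * g x l c =
    - \sum_l invmx (g x) i l * pderiv (fun y => g y l c) i x.
  apply/eqP; rewrite -subr_eq0 opprK -big_split /=; apply/eqP.
  transitivity (pderiv (fun y => \sum_l invmx (g y) i l * g y l c) i x).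
    rewrite pderiv_sum; last by move=> l; exact: (derivableM (dginv i l) (dg i l c)).
    by apply: eq_bigr => l _; rewrite (pderivM (dginv i l) (dg i l c)).
  rewrite (@pderiv_congr _ _ W _ (fun=> (1%:M : 'M[R]_d) i c)) ?pderiv_cst // => y Wy.
  by rewrite -(mulVmx (ug Wy)) mxE.
have cancel (F : 'I_d -> R) : \sum_l (\sum_k F k * invmx (g x) k l) * g x l c = F c.
  under eq_bigr do rewrite mulr_suml; rewrite exchange_big (bigD1 c) //=.
  have E k : \sum_l F k * invmx (g x) k l * g x l c = F k * (k == c)%:R.
    have -> : (k == c)%:R = (1%:M : 'M[R]_d) k c by rewrite mxE.
    rewrite -(mulVmx (ug Wx)) mxE mulr_sumr.
    by apply: eq_bigr => l _; rewrite mulrA.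
  rewrite E eqxx mulr1 big1 ?addr0 // => k kc.
  by rewrite E (negbTE kc) mulr0.
under eq_bigr do rewrite mulr_suml; rewrite exchange_big /=.
under eq_bigr do (under eq_bigr do rewrite mulrDl; rewrite big_split /= dinv cancel).
rewrite big_split /= sumrN; congr (- _ + _).
rewrite /christoffel -mulr_sumr; congr (_ * _).
have sV i l : invmx (g x) i l = invmx (g x) l i by rewrite -{1}invmx_sym // mxE.
have sgp i l p : pderiv (fun y => g y i l) p x = pderiv (fun y => g y l i) p x.
  by apply: (pderiv_congr p oW) => // y Wy; rewrite -{1}sg // mxE.
transitivity (\sum_i \sum_l (invmx (g x) i l * pderiv (fun y => g y c l) i x +
    invmx (g x) i l * pderiv (fun y => g y i l) c x -
    invmx (g x) i l * pderiv (fun y => g y i c) l x)).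
  by apply: eq_bigr => i _; apply: eq_bigr => l _; rewrite mulrBr mulrDr.
transitivity (\sum_i \sum_l invmx (g x) i l * pderiv (fun y => g y c l) i x +
    \sum_i \sum_l invmx (g x) i l * pderiv (fun y => g y i l) c x -
    \sum_i \sum_l invmx (g x) i l * pderiv (fun y => g y i c) l x).
  rewrite -big_split -sumrN -big_split; apply: eq_bigr => i _ /=.
  by rewrite -big_split -sumrN -big_split.
rewrite [X in X + _ - _]exchange_big /= addrAC.
rewrite [X in X - _](_ : _ = \sum_i \sum_l invmx (g x) i l * pderiv (fun y => g y i c) l x).
  by rewrite subrr add0r.
by apply: eq_bigr => i _; apply: eq_bigr => l _; rewrite sV sgp.
Qed.

End LaplaceBeltrami.

(** * The Maurer-Cartan form of a parametrisation *)

Section MatrixCalculus.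
Context {R : realType} {d k : nat}.
Local Notation C := R[i].
Implicit Types (M N : 'rV[R]_d -> 'M[C]_k) (x y : 'rV[R]_d) (W : set 'rV[R]_d).

Definition mxsmooth W M := forall a b, csmooth W (fun x => M x a b).

Definition mxderiv M (i : 'I_d) x : 'M[C]_k :=
  \matrix_(a, b) cpderiv (fun y => M y a b) i x.

Lemma adjmxE (A : 'M[C]_k) a b : A ^t* a b = (A b a)^*.
Proof. by rewrite !mxE. Qed.

Lemma adjmxM (A B : 'M[C]_k) : (A *m B) ^t* = B ^t* *m A ^t*.
Proof. by rewrite trmx_mul map_mxM. Qed.

Lemma mxsmooth_derivE W M i : mxsmooth W M -> mxsmooth W (mxderiv M i).
Proof. by move=> sM a b; under eq_fun do rewrite mxE; exact: csmooth_pderiv. Qed.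

Lemma mxsmooth_adj W M : open W -> mxsmooth W M -> mxsmooth W (fun x => (M x) ^t*).
Proof. by move=> oW sM a b; under eq_fun do rewrite adjmxE; exact: csmoothJ. Qed.

Lemma mxsmoothM W M N : open W -> mxsmooth W M -> mxsmooth W N ->
  mxsmooth W (fun x => M x *m N x).
Proof.
move=> oW sM sN a b; under eq_fun do rewrite mxE.
by apply: csmooth_sum => // j; exact: csmoothM.
Qed.

Lemma mxderivM W M N i x : open W -> mxsmooth W M -> mxsmooth W N -> W x ->
  mxderiv (fun y => M y *m N y) i x = mxderiv M i x *m N x + M x *m mxderiv N i x.
Proof.
move=> oW sM sN Wx; apply/matrixP => a b; rewrite !mxE -big_split /=.
under eq_fun do rewrite mxE.
rewrite (@cpderiv_sum _ _ W _ _ _ _ i x oW _ Wx); last by move=> j; exact: csmoothM.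
by apply: eq_bigr => j _; rewrite (cpderivM i (sM a j) (sN j b) Wx) !mxE.
Qed.

Lemma mxderiv_adj W M i x : mxsmooth W M -> W x ->
  mxderiv (fun y => (M y) ^t*) i x = (mxderiv M i x) ^t*.
Proof.
move=> sM Wx; apply/matrixP => a b; rewrite adjmxE !mxE -(cpderivJ i (sM b a) Wx).
by congr (cpderiv _ i x); apply/funext => y; rewrite adjmxE.
Qed.

Lemma mxderiv_cst (A : 'M[C]_k) i x : mxderiv (fun=> A) i x = 0.
Proof. by apply/matrixP => a b; rewrite !mxE cpderiv_cst. Qed.

Lemma mxderivC W M x i j : open W -> W x -> mxsmooth W M ->
  mxderiv (mxderiv M i) j x = mxderiv (mxderiv M j) i x.
Proof.
move=> oW Wx sM; apply/matrixP => a b; rewrite [LHS]mxE [RHS]mxE.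
have E l : (fun y => mxderiv M l y a b) = cpderiv (fun y => M y a b) l.
  by apply/funext => y; rewrite mxE.
apply: (etrans (congr1 (fun f => cpderiv f j x) (E i))).
exact: (etrans (cpderivC i j oW Wx (sM a b)) (esym (congr1 (fun f => cpderiv f i x) (E j)))).
Qed.

End MatrixCalculus.

Section MaurerCartan.
Context {R : realType} {d k : nat}.
Local Notation C := R[i].
Context (s : 'rV[R]_d -> unitary R k) (W : set 'rV[R]_d).
Hypothesis oW : open W.
Hypothesis sS : mxsmooth W (fun x => umx (s x)).

Local Notation S := (fun x => umx (s x)).
Local Notation E_ := (left_translate s).

Lemma umx_unitary (p : unitary R k) : umx p \is unitarymx.
Proof. exact: set_mem (valP p). Qed.

Lemma umxK (p : unitary R k) : umx p *m (umx p) ^t* = 1%:M.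
Proof. exact/unitarymxP/umx_unitary. Qed.

Lemma umxVK (p : unitary R k) : (umx p) ^t* *m umx p = 1%:M.
Proof. by apply: mulmx1C; exact: umxK. Qed.

Lemma mxderiv_umx i x : mxderiv S i x = umx (s x) *m E_ i x.
Proof. by rewrite /left_translate mulmxA umxK mul1mx. Qed.

Lemma left_translate_smooth i : mxsmooth W (E_ i).
Proof. by apply: mxsmoothM => //; [exact: mxsmooth_adj|exact: mxsmooth_derivE]. Qed.

(** Differentiate the relation s^* s = 1. *)
Lemma left_translate_skew i x : W x -> (E_ i x) ^t* = - E_ i x.
Proof.
move=> Wx; apply/eqP; rewrite -addr_eq0; apply/eqP.
have := mxderivM i oW (mxsmooth_adj oW sS) sS Wx.
rewrite (_ : (fun y => _) = fun=> 1%:M); last by apply/funext => y; exact: umxVK.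
rewrite mxderiv_cst (mxderiv_adj i sS Wx) => /esym; rewrite -[in _ ^t*]/(mxderiv S i x).
by rewrite {1}mxderiv_umx adjmxM -mulmxA umxVK mulmx1.
Qed.

(** Since E_l is the adjoint of s times d_l s, d_p E_l is - E_p E_l plus a term in the second
    derivative of s, which is symmetric and cancels in the difference. *)
Lemma maurer_cartan i j x : W x ->
  mxderiv (E_ i) j x - mxderiv (E_ j) i x = E_ i x *m E_ j x - E_ j x *m E_ i x.
Proof.
move=> Wx.
have D l p : mxderiv (E_ l) p x = - (E_ p x *m E_ l x) +
    umx (s x) ^t* *m mxderiv (mxderiv S l) p x.
  have := mxderivM p oW (mxsmooth_adj oW sS) (mxsmooth_derivE l sS) Wx.
  rewrite (mxderiv_adj p sS Wx) => ->; congr (_ + _).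
  rewrite [mxderiv S p x]mxderiv_umx [mxderiv S l x]mxderiv_umx adjmxM.
  transitivity ((E_ p x) ^t* *m ((umx (s x)) ^t* *m umx (s x)) *m E_ l x).
    by rewrite !mulmxA.
  by rewrite umxVK mulmx1 left_translate_skew // mulNmx.
rewrite !D (mxderivC i j oW Wx sS) opprD opprK addrACA subrr addr0.
by rewrite addrC.
Qed.

End MaurerCartan.

(** * Horizontal frames *)

Section Frames.
Context {K : fieldType} {k : nat} (v : rel 'I_k).
Implicit Types (A B X Y : 'M[K]_k).

(** Projection to the horizontal space: [v] marks the vertical positions. *)
Definition mask A : 'M[K]_k := \matrix_(a, b) (if v a b then 0 else A a b).

Lemma maskE A a b : mask A a b = if v a b then 0 else A a b.
Proof. by rewrite mxE. Qed.

Lemma mask_in A a b : v a b -> mask A a b = 0.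
Proof. by move=> vab; rewrite maskE vab. Qed.

Lemma mask_out A a b : ~~ v a b -> mask A a b = A a b.
Proof. by move=> /negbTE vab; rewrite maskE vab. Qed.

Lemma mxtrace_mulE A B : \tr (A *m B) = \sum_a \sum_b A a b * B b a.
Proof. by apply: eq_bigr => a _; rewrite mxE. Qed.

Hypothesis v_sym : symmetric v.
Hypothesis v_trans : transitive v.

(** As [v] is symmetric, horizontal and vertical matrices are orthogonal for the trace form. *)
Lemma mxtrace_mask A B : \tr (mask A *m B) = \tr (mask A *m mask B).
Proof.
rewrite !mxtrace_mulE; apply: eq_bigr => a _; apply: eq_bigr => b _.
by rewrite !maskE (v_sym b a); case: ifP; rewrite ?mul0r.
Qed.

(** As [v] is transitive, vertical matrices are closed under multiplication. *)
Lemma mask_mul_compl A B : mask ((A - mask A) *m (B - mask B)) = 0.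
Proof.
apply/matrixP => a b; rewrite maskE !mxE; case: ifP => // vab.
rewrite big1 // => c _; rewrite !mxE.
case: (boolP (v a c)) => vac; last by rewrite subrr mul0r.
case: (boolP (v c b)) => vcb; last by rewrite subrr mulr0.
by rewrite (v_trans vac vcb) in vab.
Qed.

Context {D : nat} (e : 'I_D -> 'M[K]_k) (G H : 'M[K]_D).
Hypothesis card_v : #|[pred p : 'I_k * 'I_k | ~~ v p.1 p.2]| = D.
Hypothesis GH : G *m H = 1%:M.
Hypothesis Ge : forall i j, G i j = - \tr (mask (e i) *m mask (e j)).

(* The frame and its transpose are square matrices, with product the Gram
   matrix: so the inverse of the Gram matrix also sits between them in the
   opposite order. *)
Lemma frame_sum (F : 'I_k -> 'I_k -> 'I_k -> 'I_k -> K) :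
  \sum_i \sum_j H i j * (\sum_a \sum_b \sum_c \sum_d
     mask (e i) a b * mask (e j) c d * F a b c d) =
  - \sum_a \sum_b (if v a b then 0 else F a b b a).
Proof.
(* An enumeration of the horizontal positions by the chart indices. Their equal number makes the
   frame a square matrix. *)
pose f (p : 'I_D) := enum_val (cast_ord (esym card_v) p).
have fv p : ~~ v (f p).1 (f p).2 by have := enum_valP (cast_ord (esym card_v) p); rewrite inE.
have f_inj : injective f by move=> p q /enum_val_inj/cast_ord_inj.
have fsum (h : 'I_k -> 'I_k -> K) : (forall a b, v a b -> h a b = 0) ->
    \sum_a \sum_b h a b = \sum_p h (f p).1 (f p).2.
  move=> h0; rewrite pair_big /= (bigID (mem [pred p : 'I_k * 'I_k | ~~ v p.1 p.2])) /=.
  rewrite [X in _ + X]big1 ?addr0; last by move=> p; rewrite inE negbK => /h0.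
  rewrite big_enum_val.
  rewrite (reindex (cast_ord (esym card_v))) //=.
  by exists (cast_ord card_v) => p _; rewrite ?cast_ordK ?cast_ordKV.
pose A := \matrix_(i, p) e i (f p).1 (f p).2.
pose B := \matrix_(p, j) - e j (f p).2 (f p).1.
have AB : A *m B = G.
  apply/matrixP => i j; rewrite Ge mxE mxtrace_mulE fsum; last first.
    by move=> a b vab; rewrite mask_in ?mul0r.
  rewrite -sumrN; apply: eq_bigr => p _.
  by rewrite !mxE (v_sym (f p).2) (negbTE (fv p)) mulrN.
have BHA : B *m H *m A = 1%:M.
  apply: mulmx1C; rewrite mulmxA AB; exact: GH.
have key p q : \sum_i \sum_j H i j * (e i (f p).2 (f p).1 * e j (f q).1 (f q).2) =
    - (p == q)%:R.
  have -> : (p == q)%:R = (B *m H *m A) p q by rewrite BHA mxE.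
  rewrite [in RHS]mxE exchange_big -sumrN /=.
  apply: eq_bigr => j _; rewrite !mxE mulr_suml -sumrN; apply: eq_bigr => i _.
  by rewrite !mxE; ring.
(* Transposition permutes the horizontal positions; f' is the induced involution of indices, needed
   because [key] has its first position transposed. *)
have [f' f'K] : exists f' : 'I_D -> 'I_D, forall p, f (f' p) = ((f p).2, (f p).1).
  have sw p : (((f p).2, (f p).1) : 'I_k * 'I_k) \in [pred p : 'I_k * 'I_k | ~~ v p.1 p.2].
    by rewrite inE /= v_sym fv.
  exists (fun p => cast_ord card_v (enum_rank_in (sw p) ((f p).2, (f p).1))) => p.
  by rewrite {1}/f cast_ordK; exact: (enum_rankK_in (sw p) (sw p)).
have f'inv : involutive f'.
  by move=> p; apply: f_inj; rewrite !f'K; case: (f p).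
transitivity (\sum_p \sum_q F (f p).1 (f p).2 (f q).1 (f q).2 *
    \sum_i \sum_j H i j * (e i (f p).1 (f p).2 * e j (f q).1 (f q).2)).
  transitivity (\sum_i \sum_j \sum_p \sum_q F (f p).1 (f p).2 (f q).1 (f q).2 *
      (H i j * (e i (f p).1 (f p).2 * e j (f q).1 (f q).2))).
    apply: eq_bigr => i _; apply: eq_bigr => j _.
    rewrite fsum; last first.
      by move=> a b vab; rewrite big1 // => c _; rewrite big1 // => d _; rewrite mask_in ?mul0r.
    rewrite mulr_sumr; apply: eq_bigr => p _.
    rewrite fsum; last by move=> c d vcd; rewrite (mask_in _ vcd) mulr0 mul0r.
    rewrite mulr_sumr; apply: eq_bigr => q _.
    by rewrite !mask_out //; ring.
  under eq_bigr do rewrite exchange_big.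
  rewrite exchange_big; apply: eq_bigr => p _.
  under eq_bigr do rewrite exchange_big.
  rewrite exchange_big; apply: eq_bigr => q _.
  rewrite mulr_sumr; apply: eq_bigr => i _.
  by rewrite mulr_sumr.
rewrite fsum; last by move=> a b ->.
rewrite -sumrN; apply: eq_bigr => p _; rewrite (negbTE (fv p)).
have fp : f p = ((f (f' p)).2, (f (f' p)).1) by rewrite f'K -surjective_pairing.
have E q : \sum_i \sum_j H i j * (e i (f p).1 (f p).2 * e j (f q).1 (f q).2) =
    - (f' p == q)%:R.
  by rewrite -key fp.
under eq_bigr do rewrite E.
rewrite (bigD1 (f' p)) //= eqxx big1 ?addr0; last first.
  by move=> q; rewrite eq_sym => /negbTE ->; rewrite oppr0 mulr0.
by rewrite f'K mulrN mulr1.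
Qed.

(** The horizontal frame spans. In [frame_sum], take F to be X transposed in its first two indices
    and the indicator of (c, d) in the last two: the left side is a combination of the traces, and
    the right side is - X c d. *)
Lemma horizontal_eq0 X : (forall i, \tr (mask (e i) *m X) = 0) -> mask X = 0.
Proof.
move=> X0; apply/matrixP => c d; rewrite maskE mxE; case: ifP => // vcd.
have := frame_sum (fun a b p q => X b a * ((p == c) && (q == d))%:R).
rewrite big1; last first.
  move=> i _; rewrite big1 // => j _.
  transitivity (H i j * (mask (e j) c d * \tr (mask (e i) *m X))); last first.
    by rewrite X0 !mulr0.
  congr (_ * _); rewrite mxtrace_mulE mulr_sumr; apply: eq_bigr => a _.
  rewrite mulr_sumr; apply: eq_bigr => b _.
  rewrite (bigD1 c) //= (bigD1 d) //= !eqxx big1 ?addr0; last first.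
    by move=> q /negbTE->; rewrite andbF !mulr0.
  rewrite big1 ?addr0; last first.
    by move=> p /negbTE-> ; rewrite big1 // => q _; rewrite !mulr0.
  by rewrite mulr1; ring.
move/esym/eqP; rewrite oppr_eq0 => /eqP <-.
rewrite (bigD1 d) //= (bigD1 c) //= v_sym vcd !eqxx mulr1 big1 ?addr0; last first.
  by move=> q /negbTE->; case: ifP => // _; rewrite mulr0.
rewrite big1 ?addr0 // => p /negbTE pd; rewrite big1 // => q _.
by rewrite pd andbF mulr0; case: ifP.
Qed.

Hypothesis H_sym : forall i j, H i j = H j i.

(** Split every e into its horizontal part and h. Products of two h vanish against a horizontal
    matrix, the terms containing h i cancel after cyclic rotation of traces, and the remainder is
    antisymmetric in i and j while H is symmetric. *)
Lemma frame_bracket c :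
  let h i := e i - mask (e i) in
  \sum_i \sum_j H i j *
    (\tr (mask (e c) *m (h i *m mask (e j) - mask (e j) *m h i)) +
     \tr (mask (e j) *m (e i *m e c - e c *m e i))) = 0.
Proof.
move=> h.
have he i : e i = mask (e i) + h i by rewrite addrC subrK.
have hh i j l : \tr (mask (e l) *m (h i *m h j)) = 0.
  by rewrite mxtrace_mask mask_mul_compl mulmx0 mxtrace0.
clearbody h.
have rot (X Y Z : 'M[K]_k) : \tr (X *m (Y *m Z)) = \tr (Y *m (Z *m X)).
  by rewrite mxtrace_mulC -mulmxA.
pose u i j := \tr (mask (e i) *m (mask (e c) *m mask (e j))).
pose w i j := \tr (h c *m (mask (e i) *m mask (e j))).
transitivity (\sum_i \sum_j H i j * ((u i j - u j i) + (w j i - w i j))).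
  apply: eq_bigr => i _; apply: eq_bigr => j _; congr (_ * _).
  have r1 : \tr (mask (e c) *m (h i *m mask (e j))) = \tr (mask (e j) *m (mask (e c) *m h i)).
    by rewrite rot rot.
  have r2 : \tr (mask (e c) *m (mask (e j) *m h i)) = \tr (mask (e j) *m (h i *m mask (e c))).
    by rewrite rot.
  have r3 : u i j = \tr (mask (e j) *m (mask (e i) *m mask (e c))) by rewrite /u rot rot.
  have r4 : w j i = \tr (mask (e j) *m (mask (e i) *m h c)) by rewrite /w rot.
  have r5 : w i j = \tr (mask (e j) *m (h c *m mask (e i))) by rewrite /w rot rot.
  have Eic : e i *m e c = mask (e i) *m mask (e c) + mask (e i) *m h c +
      (h i *m mask (e c) + h i *m h c).
    by rewrite {1}[e i]he {1}[e c]he mulmxDl !mulmxDr.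
  have Eci : e c *m e i = mask (e c) *m mask (e i) + mask (e c) *m h i +
      (h c *m mask (e i) + h c *m h i).
    by rewrite {1}[e i]he {1}[e c]he mulmxDl !mulmxDr.
  rewrite Eic Eci !mulmxBr !mulmxDr !raddfB /= !mxtraceD.
  rewrite !hh r1 r2 r3 r4 r5 /u.
  ring.
rewrite (eq_bigr (fun i => \sum_j (H i j * (w j i - u j i) - H i j * (w i j - u i j)))); last first.
  by move=> i _; apply: eq_bigr => j _; ring.
under eq_bigr do rewrite sumrB; rewrite sumrB exchange_big /=.
apply/eqP; rewrite subr_eq0; apply/eqP.
by apply: eq_bigr => i _; apply: eq_bigr => j _; rewrite H_sym.
Qed.

End Frames.

(** * The Gram matrix of a lifted chart and its first-order coefficients *)

Section LiftedChart.
Context {R : realType} {k D : nat} (v : rel 'I_k) (hor : 'M[R[i]]_k -> 'M[R[i]]_k).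
Local Notation C := R[i].
Context (s : 'rV[R]_D -> unitary R k) (W : set 'rV[R]_D).
Hypothesis v_sym : symmetric v.
Hypothesis v_trans : transitive v.
Hypothesis card_v : #|[pred p : 'I_k * 'I_k | ~~ v p.1 p.2]| = D.
Hypothesis horE : forall Z, hor Z = mask v Z.
Hypothesis oW : open W.
Hypothesis sS : mxsmooth W (fun x => umx (s x)).
Hypothesis ug : forall x, W x -> gram hor s x \in unitmx.

Local Notation E_ := (left_translate s).
Local Notation g := (gram hor s).

Lemma mask_adj (A : 'M[C]_k) : mask v (A ^t*) = (mask v A) ^t*.
Proof.
apply/matrixP => a b; rewrite adjmxE !maskE adjmxE v_sym.
by case: ifP; rewrite ?rmorph0.
Qed.

Lemma maskN (A : 'M[C]_k) : mask v (- A) = - mask v A.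
Proof. by apply/matrixP => a b; rewrite !mxE; case: ifP; rewrite ?oppr0. Qed.

Lemma mxtrace_adj (A : 'M[C]_k) : \tr (A ^t*) = (\tr A)^*.
Proof. by rewrite rmorph_sum; apply: eq_bigr => a _; rewrite adjmxE. Qed.

Lemma mask_skew i x : W x -> (mask v (E_ i x)) ^t* = - mask v (E_ i x).
Proof. by move=> Wx; rewrite -mask_adj (left_translate_skew oW sS i Wx) maskN. Qed.

(** The trace of a product of two skew-Hermitian matrices is real: its conjugate is the trace of the
    product in the other order. So the metric is the restriction of a complex-bilinear form. *)
Lemma inner_skew (A B : 'M[C]_k) : A ^t* = - A -> B ^t* = - B ->
  real_complex R (inner A B) = - \tr (A *m B).
Proof.
move=> sA sB; rewrite /inner sB mulmxN raddfN /=.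
set t := \tr _; have tJ : t^* = t.
  by rewrite -mxtrace_adj adjmxM sA sB mulNmx mulmxN opprK; exact: mxtrace_mulC.
have t0 : complex.Im t = 0.
  have := congr1 (@complex.Im R) tJ; rewrite cImJ => tN; lra.
by apply: complexE; rewrite /= ?cReN ?cImN ?t0 ?oppr0.
Qed.

Lemma gramE i j x : W x ->
  real_complex R (g x i j) = - \tr (mask v (E_ i x) *m mask v (E_ j x)).
Proof.
move=> Wx; have E : g x i j = inner (mask v (E_ i x)) (mask v (E_ j x)).
  by rewrite [LHS]mxE; congr inner; exact: horE.
exact: (etrans (congr1 _ E) (inner_skew (mask_skew i Wx) (mask_skew j Wx))).
Qed.

Lemma gram_sym x : W x -> (g x)^T = g x.
Proof.
move=> Wx; apply/matrixP => i j; rewrite mxE.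
have := gramE j i Wx; rewrite mxtrace_mulC -(gramE i j Wx).
by move/(congr1 (@complex.Re R)).
Qed.

Lemma cpderiv_real (u : 'rV[R]_D -> R) i x :
  cpderiv (fun y => real_complex R (u y)) i x = real_complex R (pderiv u i x).
Proof. by apply: complexE => //=; exact: pderiv_cst. Qed.

Lemma cpderiv_tr (M : 'rV[R]_D -> 'M[C]_k) i x : mxsmooth W M -> W x ->
  cpderiv (fun y => \tr (M y)) i x = \tr (mxderiv M i x).
Proof.
move=> sM Wx; rewrite [LHS](@cpderiv_sum _ _ W _ _ _ _ i x oW _ Wx).
  by apply: eq_bigr => a _; rewrite mxE.
by move=> a; exact: sM.
Qed.

Lemma mxsmooth_mask (M : 'rV[R]_D -> 'M[C]_k) : mxsmooth W M ->
  mxsmooth W (fun x => mask v (M x)).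
Proof.
move=> sM a b; under eq_fun do rewrite maskE.
by case: (v a b); [exact: csmooth_cst|exact: sM].
Qed.

Lemma mxderiv_mask (M : 'rV[R]_D -> 'M[C]_k) i x :
  mxderiv (fun y => mask v (M y)) i x = mask v (mxderiv M i x).
Proof.
apply/matrixP => a b; rewrite [LHS]mxE [RHS]mxE [in RHS]mxE.
under eq_fun do rewrite maskE.
by case: (v a b) => //; rewrite cpderiv_cst.
Qed.

Lemma frame_smooth i : mxsmooth W (fun x => mask v (E_ i x)).
Proof. exact: mxsmooth_mask (left_translate_smooth oW sS i). Qed.

Lemma csmooth_tr (M : 'rV[R]_D -> 'M[C]_k) : mxsmooth W M ->
  csmooth W (fun x => \tr (M x)).
Proof. by move=> sM; apply: csmooth_sum => // a; exact: sM. Qed.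

Lemma gram_Ck n i j : Ck n W (fun x => g x i j).
Proof.
have [+ _] := csmoothN oW (csmooth_tr (mxsmoothM oW (frame_smooth i) (frame_smooth j))).
move=> /(_ n); apply: Ck_congr => // x Wx.
by rewrite -(gramE i j Wx).
Qed.

(** Only one factor of each trace is masked: by orthogonality, the vertical part of the
    differentiated factor does not contribute. *)
Lemma pderiv_gram i j c x : W x ->
  real_complex R (pderiv (fun y => g y i j) c x) =
  - (\tr (mask v (E_ j x) *m mxderiv (E_ i) c x) +
     \tr (mask v (E_ i x) *m mxderiv (E_ j) c x)).
Proof.
move=> Wx; rewrite -cpderiv_real.
have sij := mxsmoothM oW (frame_smooth i) (frame_smooth j).
rewrite (cpderiv_congr c oW (fun y Wy => gramE i j Wy) Wx).
rewrite (cpderivN c (csmooth_tr sij) Wx) (cpderiv_tr c sij Wx); congr (- _).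
apply: (etrans (congr1 _ (mxderivM c oW (frame_smooth i) (frame_smooth j) Wx))).
apply: (etrans (mxtraceD _ _)); apply: (f_equal2 +%R).
  apply: (etrans (congr1 (fun X => \tr (X *m _)) (mxderiv_mask (E_ i) c x))).
  exact: (etrans (mxtrace_mulC _ _) (esym (mxtrace_mask v_sym _ _))).
apply: (etrans (congr1 (fun X => \tr (_ *m X)) (mxderiv_mask (E_ j) c x))).
exact: (esym (mxtrace_mask v_sym _ _)).
Qed.

Definition cometric x i l : C := real_complex R (invmx (g x) i l).

(** The vertical part of [E_ i], in the isotropy algebra. For the Grassmannian it depends on the
    chosen lift. *)
Definition hframe i x : 'M[C]_k := E_ i x - mask v (E_ i x).

Lemma cometric_mul x : W x ->
  map_mx (real_complex R) (g x) *m map_mx (real_complex R) (invmx (g x)) = 1%:M.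
Proof. by move=> Wx; rewrite -map_mxM mulmxV ?ug // map_mx1. Qed.

Lemma cometric_sym x i l : W x -> cometric x i l = cometric x l i.
Proof.
move=> Wx; congr (real_complex R _).
by rewrite -{1}(invmx_sym gram_sym Wx) mxE.
Qed.

Lemma frame_contraction x (F : 'I_k -> 'I_k -> 'I_k -> 'I_k -> C) : W x ->
  \sum_i \sum_j cometric x i j * (\sum_a \sum_b \sum_c \sum_e
     mask v (E_ i x) a b * mask v (E_ j x) c e * F a b c e) =
  - \sum_a \sum_b (if v a b then 0 else F a b b a).
Proof.
move=> Wx.
have := @frame_sum _ _ _ v_sym _ (fun i => E_ i x) _ _ card_v (cometric_mul Wx) _ F.
move=> <- => [|i j]; last by rewrite mxE; exact: gramE.
by apply: eq_bigr => i _; apply: eq_bigr => j _; rewrite mxE.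
Qed.

(* The tension of a function is the pairing of this matrix with the matrix of
   its left-invariant derivatives, when the latter vanishes on v. *)
Definition tension_matrix x : 'M[C]_k :=
  \sum_i \sum_l cometric x i l *: (mxderiv (E_ l) i x +
     (hframe i x *m mask v (E_ l x) - mask v (E_ l x) *m hframe i x)) +
  \sum_l real_complex R (drift g l x) *: E_ l x.

(** Tested against e_c, the drift contributes - t1 - t3 + t4 by [drift_metric]. Added to t1 + t2
    this leaves t2 + (t4 - t3); by Maurer-Cartan the difference t4 - t3 is the trace of e_l against
    [E_i, E_c], and [frame_bracket] gives zero. *)
Lemma mask_tension x : W x -> mask v (tension_matrix x) = 0.
Proof.
move=> Wx; have gE i j : map_mx (real_complex R) (g x) i j =
    - \tr (mask v (E_ i x) *m mask v (E_ j x)) by rewrite mxE; exact: gramE.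
apply: (@horizontal_eq0 _ _ v v_sym _ (fun i => E_ i x) _ _ card_v (cometric_mul Wx) gE) => c.
pose t1 i l := \tr (mask v (E_ c x) *m mxderiv (E_ l) i x).
pose t2 i l := \tr (mask v (E_ c x) *m
  (hframe i x *m mask v (E_ l x) - mask v (E_ l x) *m hframe i x)).
pose t3 i l := \tr (mask v (E_ l x) *m mxderiv (E_ c) i x).
pose t4 i l := \tr (mask v (E_ l x) *m mxderiv (E_ i) c x).
have bracket : \sum_i \sum_l cometric x i l * (t2 i l + (t4 i l - t3 i l)) = 0.
  have Hsym i j : map_mx (real_complex R) (invmx (g x)) i j =
      map_mx (real_complex R) (invmx (g x)) j i.
    by rewrite !mxE; exact: cometric_sym.
  have := @frame_bracket _ _ v v_sym v_trans _ (fun i => E_ i x) _ Hsym c.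
  move=> /= bE; rewrite -[RHS]bE; apply: eq_bigr => i _; apply: eq_bigr => l _.
  rewrite mxE; congr (_ * (_ + _)); rewrite /t4 /t3.
  by rewrite -(maurer_cartan oW sS i c Wx) mulmxBr raddfB.
have dgl i l : real_complex R (pderiv (fun y => g y l c) i x) = - (t1 i l + t3 i l).
  exact: pderiv_gram.
have dgi i l : real_complex R (pderiv (fun y => g y i l) c x) = - (t4 i l + t4 l i).
  exact: pderiv_gram.
have E12 i l : \tr (mask v (E_ c x) *m (mxderiv (E_ l) i x +
    (hframe i x *m mask v (E_ l x) - mask v (E_ l x) *m hframe i x))) = t1 i l + t2 i l.
  exact: (etrans (congr1 _ (mulmxDr _ _ _)) (mxtraceD _ _)).
have gc l : - real_complex R (g x l c) = \tr (mask v (E_ c x) *m E_ l x).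
  apply: (etrans (congr1 -%R (gramE l c Wx))); apply: (etrans (opprK _)).
  exact: (etrans (mxtrace_mulC _ _) (esym (mxtrace_mask v_sym _ _))).
clearbody t1 t2 t3 t4.
have Hsym i l : cometric x i l = cometric x l i by exact: cometric_sym.
(* Symmetry of the cometric merges t4 i l with t4 l i, which absorbs the factor 1/2 of
   [drift_metric]. *)
have driftE : \sum_l real_complex R (drift g l x) * \tr (mask v (E_ c x) *m E_ l x) =
    \sum_i \sum_l cometric x i l * (- t1 i l - t3 i l) +
    \sum_i \sum_l cometric x i l * t4 i l.
  transitivity (- real_complex R (\sum_l drift g l x * g x l c)).
    rewrite rmorph_sum -sumrN; apply: eq_bigr => l _ /=.
    by rewrite -gc rmorphM mulrN.
  apply: (etrans (congr1 (fun r => - real_complex R r)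
    (drift_metric oW (gram_Ck 1) ug gram_sym c Wx))).
  have -> : \sum_i \sum_l cometric x i l * (- t1 i l - t3 i l) = 
     real_complex R (\sum_i \sum_l invmx (g x) i l * pderiv (fun y => g y l c) i x).
    rewrite rmorph_sum; apply: eq_bigr => i _; rewrite rmorph_sum; apply: eq_bigr => l _.
    by rewrite -opprD -dgl -rmorphM.
  have -> : \sum_i \sum_l cometric x i l * t4 i l = - 2^-1 *
     real_complex R (\sum_i \sum_l invmx (g x) i l * pderiv (fun y => g y i l) c x).
    have -> : real_complex R (\sum_i \sum_l invmx (g x) i l * pderiv (fun y => g y i l) c x) =
      - (\sum_i \sum_l cometric x i l * t4 i l + \sum_i \sum_l cometric x i l * t4 l i).
      rewrite -big_split -sumrN rmorph_sum; apply: eq_bigr => i _ /=.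
      rewrite -big_split -sumrN rmorph_sum; apply: eq_bigr => l _ /=.
      by rewrite rmorphM /= dgi mulrN mulrDr.
    have -> : \sum_i \sum_l cometric x i l * t4 l i = \sum_i \sum_l cometric x i l * t4 i l.
      rewrite exchange_big; apply: eq_bigr => i _; apply: eq_bigr => l _.
      by rewrite Hsym.
    by field.
  move: (\sum_i _) (\sum_i _) => A B.
  rewrite rmorphD rmorphN rmorphM fmorphV rmorph_nat.
  by ring.
rewrite /tension_matrix mulmxDr mxtraceD !mulmx_sumr !raddf_sum /=.
transitivity (\sum_i \sum_l cometric x i l * (t1 i l + t2 i l) +
    \sum_l real_complex R (drift g l x) * \tr (mask v (E_ c x) *m E_ l x)).
  apply: (f_equal2 +%R); last first.
    by apply: eq_bigr => l _; rewrite -scalemxAr mxtraceZ.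
  apply: eq_bigr => i _; rewrite mulmx_sumr raddf_sum; apply: eq_bigr => l _ /=.
  by rewrite -scalemxAr mxtraceZ -E12.
rewrite driftE -[RHS]bracket addrA -big_split -big_split; apply: eq_bigr => i _ /=.
by rewrite -big_split -big_split; apply: eq_bigr => l _ /=; ring.
Qed.

End LiftedChart.

Section HorizontalFunction.
Context {R : realType} {k D : nat} (v : rel 'I_k) (hor : 'M[R[i]]_k -> 'M[R[i]]_k).
Local Notation C := R[i].
Context (s : 'rV[R]_D -> unitary R k) (W : set 'rV[R]_D).
Hypothesis v_sym : symmetric v.
Hypothesis v_trans : transitive v.
Hypothesis card_v : #|[pred p : 'I_k * 'I_k | ~~ v p.1 p.2]| = D.
Hypothesis horE : forall Z, hor Z = mask v Z.
Hypothesis oW : open W.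
Hypothesis sS : mxsmooth W (fun x => umx (s x)).
Hypothesis ug : forall x, W x -> gram hor s x \in unitmx.

Local Notation E_ := (left_translate s).
Local Notation g := (gram hor s).

(* F a b and F2 c e a b are the first and second derivatives of w along
   left-invariant vector fields. *)
Context (w : 'rV[R]_D -> C) (F : 'I_k -> 'I_k -> 'rV[R]_D -> C)
  (F2 : 'I_k -> 'I_k -> 'I_k -> 'I_k -> 'rV[R]_D -> C).
Hypothesis F_smooth : forall a b, csmooth W (F a b).
Hypothesis F_horizontal : forall a b x, W x -> v a b -> F a b x = 0.
Hypothesis w_deriv : forall i x, W x ->
  cpderiv w i x = \sum_a \sum_b E_ i x a b * F a b x.
Hypothesis F_deriv : forall a b i x, W x ->
  cpderiv (F a b) i x = \sum_c \sum_e E_ i x c e * F2 c e a b x.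
Hypothesis F2_vertical : forall a b c e x, W x -> v c e ->
  F2 c e a b x = (e == a)%:R * F c b x - (b == c)%:R * F a e x.
Hypothesis F2_swap : forall a b x, W x -> ~~ v a b -> F2 b a a b x = 0.
Hypothesis F_nilpotent : forall a b x, W x -> F a b x * F b a x = 0.

Lemma w_deriv_mask i x : W x ->
  cpderiv w i x = \sum_a \sum_b mask v (E_ i x) a b * F a b x.
Proof.
move=> Wx; rewrite w_deriv //; apply: eq_bigr => a _; apply: eq_bigr => b _.
by rewrite maskE; case: ifP => // vab; rewrite F_horizontal // mul0r mulr0.
Qed.

Lemma horizontal_conformal x : W x ->
  \sum_i \sum_l cometric hor s x i l * (cpderiv w i x * cpderiv w l x) = 0.
Proof.
move=> Wx.
transitivity (- \sum_a \sum_b (if v a b then 0 else F a b x * F b a x)); last first.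
  rewrite big1 ?oppr0 // => a _; rewrite big1 // => b _.
  by rewrite F_nilpotent //; case: ifP.
rewrite -(frame_contraction v_sym card_v horE oW sS ug (fun a b c e => F a b x * F c e x) Wx).
apply: eq_bigr => i _; apply: eq_bigr => l _; rewrite !w_deriv_mask //.
move: (mask v (E_ i x)) (mask v (E_ l x)) (cometric _ _ _ _ _) => A B r.
congr (_ * _); rewrite mulr_suml; apply: eq_bigr => a _; rewrite mulr_suml.
apply: eq_bigr => b _; rewrite mulr_sumr; apply: eq_bigr => c _.
by rewrite mulr_sumr; apply: eq_bigr => e _; ring.
Qed.

(** The pairing with the first derivatives of w. The name hides the projection to the Grassmannian
    in this section. *)
Let pr x (A : 'M[C]_k) := \sum_a \sum_b A a b * F a b x.

Let prD x (A B : 'M[C]_k) : pr x (A + B) = pr x A + pr x B.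
Proof.
rewrite -big_split; apply: eq_bigr => a _; rewrite -big_split.
by apply: eq_bigr => b _; rewrite mxE mulrDl.
Qed.

Let prZ x c (A : 'M[C]_k) : pr x (c *: A) = c * pr x A.
Proof.
rewrite mulr_sumr; apply: eq_bigr => a _; rewrite mulr_sumr.
by apply: eq_bigr => b _; rewrite mxE mulrA.
Qed.

Let prB x (A B : 'M[C]_k) : pr x (A - B) = pr x A - pr x B.
Proof. by rewrite -scaleN1r prD prZ mulN1r. Qed.

Let pr_sum x (A : 'I_D -> 'M[C]_k) : pr x (\sum_i A i) = \sum_i pr x (A i).
Proof.
rewrite /pr [RHS]exchange_big; apply: eq_bigr => a _ /=; rewrite [RHS]exchange_big.
by apply: eq_bigr => b _ /=; rewrite summxE mulr_suml.
Qed.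

Let pr_tension x : W x -> pr x (tension_matrix v hor s x) = 0.
Proof.
move=> Wx; have m0 := mask_tension v_sym v_trans card_v horE oW sS ug Wx.
rewrite /pr big1 // => a _; rewrite big1 // => b _.
have [vab|vab] := boolP (v a b); first by rewrite F_horizontal // mulr0.
by rewrite -(mask_out _ vab) m0 mxE mul0r.
Qed.

(** Along a vertical A, a second derivative of w is the adjoint action of A on its first
    derivatives, by [F2_vertical]. *)
Let pr_bracket x (A B : 'M[C]_k) : W x -> (forall a b, ~~ v a b -> A a b = 0) ->
  \sum_a \sum_b B a b * (\sum_c \sum_e A c e * F2 c e a b x) =
  pr x (A *m B - B *m A).
Proof.
move=> Wx A0.
transitivity (\sum_a \sum_b B a b * (\sum_c \sum_e A c e *
   ((e == a)%:R * F c b x)) - \sum_a \sum_b B a b * (\sum_c \sum_e A c e *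
   ((b == c)%:R * F a e x))).
  rewrite -sumrN -big_split; apply: eq_bigr => a _; rewrite /= -sumrN -big_split.
  apply: eq_bigr => b _; rewrite /= -mulrBr; congr (_ * _).
  rewrite -sumrN -big_split; apply: eq_bigr => c _; rewrite /= -sumrN -big_split.
  apply: eq_bigr => e _; rewrite /= -mulrBr.
  have [vce|vce] := boolP (v c e); first by rewrite F2_vertical.
  by rewrite A0 // !mul0r.
rewrite prB; congr (_ - _).
  transitivity (\sum_a \sum_b \sum_c A c a * B a b * F c b x).
    apply: eq_bigr => a _; apply: eq_bigr => b _; rewrite mulr_sumr.
    apply: eq_bigr => c _; rewrite (bigD1 a) //= eqxx mul1r big1 ?addr0; first by ring.
    by move=> e /negbTE ->; rewrite mul0r mulr0.
  rewrite [LHS]exchange_big [RHS]exchange_big; apply: eq_bigr => b _ /=.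
  rewrite [LHS]exchange_big; apply: eq_bigr => c _ /=.
  by rewrite mxE mulr_suml.
transitivity (\sum_a \sum_b \sum_e B a b * A b e * F a e x).
  apply: eq_bigr => a _; apply: eq_bigr => b _.
  rewrite (bigD1 b) //= [X in _ * (_ + X)]big1 ?addr0; last first.
    by move=> c cb; rewrite big1 // => e _; rewrite [b == c]eq_sym (negbTE cb) mul0r mulr0.
  by rewrite mulr_sumr; apply: eq_bigr => e _; rewrite eqxx mul1r; ring.
apply: eq_bigr => a _; rewrite [LHS]exchange_big; apply: eq_bigr => e _ /=.
by rewrite mxE mulr_suml.
Qed.

(** The factor of the derivative of F may be masked because F vanishes identically on W at vertical
    positions. *)
Lemma w_deriv2 i l x : W x -> cpderiv (cpderiv w l) i x =
  pr x (mxderiv (E_ l) i x) +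
  \sum_a \sum_b mask v (E_ l x) a b * cpderiv (F a b) i x.
Proof.
move=> Wx; rewrite (cpderiv_congr i oW (fun y Wy => w_deriv l Wy) Wx).
have sE a b := left_translate_smooth oW sS l a b.
have sEF a b := csmoothM oW (sE a b) (F_smooth a b).
rewrite (cpderiv_sum _ _ _ oW _ Wx); last by move=> a; exact: csmooth_sum.
rewrite -big_split; apply: eq_bigr => a _.
rewrite (cpderiv_sum _ _ _ oW (sEF a) Wx) /= -big_split; apply: eq_bigr => b _ /=.
rewrite (cpderivM i (sE a b) (F_smooth a b) Wx); apply: (f_equal2 +%R).
  by apply: (f_equal2 *%R) => //; rewrite [RHS]mxE.
rewrite maskE; case: ifP => // vab.
rewrite (@cpderiv_congr _ _ W (F a b) (fun=> 0) i x oW _ Wx).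
  by rewrite cpderiv_cst mulr0 mul0r.
by move=> y Wy; exact: F_horizontal.
Qed.

Lemma horizontal_tension x : W x ->
  \sum_i \sum_l cometric hor s x i l * cpderiv (cpderiv w l) i x +
  \sum_l real_complex R (drift g l x) * cpderiv w l x = 0.
Proof.
move=> Wx; rewrite -[RHS](pr_tension Wx) prD !pr_sum; apply: (f_equal2 +%R); last first.
  by apply: eq_bigr => l _; rewrite prZ w_deriv.
(* The purely horizontal second-order part contracts to terms covered by [F2_swap], so it can be
   subtracted at no cost. *)
have contr := frame_contraction v_sym card_v horE oW sS ug
  (fun c e a b => F2 c e a b x) Wx.
rewrite [X in _ = - X]big1 ?oppr0 in contr; last first.
  move=> a _; rewrite big1 // => b _; case: ifPn => // vab.
  by rewrite F2_swap // v_sym.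
transitivity (\sum_i \sum_l cometric hor s x i l * cpderiv (cpderiv w l) i x -
   \sum_i \sum_j cometric hor s x i j * (\sum_a \sum_b \sum_c \sum_e
     mask v (E_ i x) a b * mask v (E_ j x) c e * F2 a b c e x)).
  by rewrite contr subr0.
rewrite -sumrN -big_split; apply: eq_bigr => i _ /=.
rewrite -sumrN -big_split pr_sum; apply: eq_bigr => l _ /=.
rewrite -mulrBr prZ; apply: (f_equal2 *%R) => //.
rewrite w_deriv2 // prD -addrA; apply: (f_equal2 +%R) => //.
(* What is left of the second derivative comes from the vertical part of E_i. It becomes the
   commutator inside [tension_matrix]. *)
have hv a b : ~~ v a b -> hframe v s i x a b = 0.
  by move=> vab; rewrite !mxE (negbTE vab) subrr.
rewrite -(pr_bracket _ Wx hv).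
rewrite [X in _ - X](_ : _ = \sum_a \sum_b mask v (E_ l x) a b *
    (\sum_c \sum_e mask v (E_ i x) c e * F2 c e a b x)); last first.
  under eq_bigr do rewrite exchange_big.
  rewrite exchange_big; apply: eq_bigr => a _ /=.
  under eq_bigr do rewrite exchange_big.
  rewrite exchange_big; apply: eq_bigr => b _ /=; rewrite mulr_sumr; apply: eq_bigr => c _.
  by rewrite mulr_sumr; apply: eq_bigr => e _; ring.
rewrite -sumrN -big_split; apply: eq_bigr => a _ /=.
rewrite -sumrN -big_split; apply: eq_bigr => b _ /=.
rewrite -mulrBr; congr (_ * _); rewrite F_deriv //.
rewrite -sumrN -big_split; apply: eq_bigr => c _ /=.
rewrite -sumrN -big_split; apply: eq_bigr => e _ /=.
by rewrite -mulrBl /hframe !mxE.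
Qed.

End HorizontalFunction.

(** * Quotients of polynomials in the minors *)

Section QuotientIdentities.
Variable K : fieldType.
Implicit Types A B E y z w u r : K.

(** This and the next identities are stated over a bare field so that [field] and [ring] meet
    variables instead of evaluated polynomials. *)
Lemma quotient_rule_split A B y z : y != 0 ->
  (A * y - z * B) / y ^+ 2 = A / y - z / y ^+ 2 * B.
Proof. by move=> y0; field. Qed.

Lemma quotient_rule_term A B y z u : y != 0 ->
  u * A / y - z / y ^+ 2 * (u * B) = u * ((A * y - z * B) / y ^+ 2).
Proof. by move=> y0; field. Qed.

Lemma square_quotient_rule A B y z : y != 0 ->
  (A * (y * y) - z * (B * y + y * B)) / (y * y) ^+ 2 =
  A / y ^+ 2 - 2 * z / y ^+ 3 * B.
Proof. by move=> y0; field. Qed.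

Lemma square_quotient_term A B y z u :
  u * A / y ^+ 2 - 2 * z / y ^+ 3 * (u * B) =
  u * (A / y ^+ 2 - 2 * z * B / y ^+ 3).
Proof. by ring. Qed.

Lemma bracket_quotient A B E y w u r : y != 0 ->
  (w *+ 2 * A + (u * B - r * E)) / y ^+ 2 - 2 * A * (w * y) / y ^+ 3 =
  u * (B / y ^+ 2) - r * (E / y ^+ 2).
Proof. by move=> y0; field. Qed.

Lemma leibniz_term A B y z u : u * A * z + y * (u * B) = u * (A * z + y * B).
Proof. by ring. Qed.

End QuotientIdentities.

Section PolynomialOnChart.
Import -(notations) mpoly.
Context {R : realType} {k D : nat}.
Local Notation C := R[i].
Context (s : 'rV[R]_D -> unitary R k) (W : set 'rV[R]_D).
Hypothesis oW : open W.
Hypothesis sS : mxsmooth W (fun x => umx (s x)).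

Definition chart_eval (F : mpoly (k * k) C) x : C := mxeval (umx (s x)) F.

Lemma chart_evalD F G x : chart_eval (F + G) x = chart_eval F x + chart_eval G x.
Proof. exact: rmorphD. Qed.

Lemma chart_evalB F G x : chart_eval (F - G) x = chart_eval F x - chart_eval G x.
Proof. exact: rmorphB. Qed.

Lemma chart_evalM F G x : chart_eval (F * G) x = chart_eval F x * chart_eval G x.
Proof. exact: rmorphM. Qed.

Lemma chart_evalZ c F x : chart_eval (c *: F) x = c * chart_eval F x.
Proof. exact: mxevalZ. Qed.

Lemma chart_eval0 x : chart_eval 0 x = 0.
Proof. exact: rmorph0. Qed.

Lemma chart_eval_nat n F x : chart_eval (n%:R * F) x = n%:R * chart_eval F x.
Proof. by rewrite chart_evalM; congr (_ * _); exact: rmorph_nat. Qed.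

Lemma chart_eval_bracket c F G H (i j : nat) x :
  chart_eval (c *: F + (i%:R * G - j%:R * H)) x =
  c * chart_eval F x + (i%:R * chart_eval G x - j%:R * chart_eval H x).
Proof. by rewrite chart_evalD chart_evalB !chart_eval_nat chart_evalZ. Qed.

Lemma chart_eval_smooth F : csmooth W (chart_eval F).
Proof.
move: F; apply: (@mpoly_mxind R[i] k (fun F => csmooth W (chart_eval F))) => [c|a b|F G IF IG|F G IF IG].
- by rewrite /chart_eval; under eq_fun do rewrite mxevalC; exact: csmooth_cst.
- by rewrite /chart_eval; under eq_fun do rewrite mxeval_coord; exact: sS.
- by rewrite /chart_eval; under eq_fun do rewrite rmorphD; exact: csmoothD.
- by rewrite /chart_eval; under eq_fun do rewrite rmorphM; exact: csmoothM.
Qed.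

(** Both sides satisfy the Leibniz rule in F, so it suffices to treat the entries, where the claim
    reads d_i s = s E_i. *)
Lemma cpderiv_chart_eval F i x : W x -> cpderiv (chart_eval F) i x =
  \sum_a \sum_b left_translate s i x a b * chart_eval (lfield a b F) x.
Proof.
move=> Wx; have sF := chart_eval_smooth.
move: F; apply: (@mpoly_mxind R[i] k (fun F => cpderiv (chart_eval F) i x =
  \sum_a \sum_b left_translate s i x a b * chart_eval (lfield a b F) x)) => [c|c e|F G IF IG|F G IF IG].
- rewrite (_ : chart_eval _ = fun=> c); last by apply/funext => y; exact: mxevalC.
  rewrite cpderiv_cst big1 // => a _; rewrite big1 // => b _.
  by rewrite lfieldC chart_eval0 mulr0.
- rewrite (_ : chart_eval _ = fun y => umx (s y) c e); last first.
    by apply/funext => y; exact: mxeval_coord.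
  have -> : cpderiv (fun y => umx (s y) c e) i x =
      mxderiv (fun y => umx (s y)) i x c e by rewrite [RHS]mxE.
  apply: (etrans (congr1 (fun M : 'M[C]_k => M c e) (mxderiv_umx s i x))).
  rewrite mxE; apply: eq_bigr => a _; rewrite (bigD1 e) //= big1 ?addr0.
    by rewrite lfield_coord eqxx mul1r /chart_eval mxeval_coord mulrC.
  move=> b; rewrite eq_sym => /negbTE eb.
  by rewrite lfield_coord eb mul0r chart_eval0 mulr0.
- rewrite (_ : chart_eval _ = fun y => chart_eval F y + chart_eval G y); last first.
    by apply/funext => y; exact: rmorphD.
  rewrite (cpderivD i (sF F) (sF G) Wx) IF IG -big_split; apply: eq_bigr => a _ /=.
  rewrite -big_split; apply: eq_bigr => b _ /=.
  by rewrite lfieldD chart_evalD mulrDr.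
- rewrite (_ : chart_eval _ = fun y => chart_eval F y * chart_eval G y); last first.
    by apply/funext => y; exact: rmorphM.
  rewrite (cpderivM i (sF F) (sF G) Wx) IF IG mulr_suml mulr_sumr -big_split.
  apply: eq_bigr => a _ /=; rewrite mulr_suml mulr_sumr -big_split.
  apply: eq_bigr => b _ /=.
  rewrite lfieldM chart_evalD !chart_evalM.
  exact: leibniz_term.
Qed.

Section Ratio.
Context (p q : mpoly (k * k) C) (par : rel 'I_k) (wt : 'I_k -> 'I_k -> C).
Hypothesis q0 : forall x, W x -> chart_eval q x != 0.
Hypothesis par_p : forall a b, par a b -> lfield a b p = wt a b *: p.
Hypothesis par_q : forall a b, par a b -> lfield a b q = wt a b *: q.

Let N := wronskian p q.

Definition ratio x : C := chart_eval p x / chart_eval q x.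

(** The derivative of p / q along L_ab; [ratio2] is the derivative of this one along L_ce. *)
Definition ratio1 a b x : C := chart_eval (N a b) x / chart_eval q x ^+ 2.

Definition ratio2 c e a b x : C :=
  chart_eval (lfield c e (N a b)) x / chart_eval q x ^+ 2 -
  2 * chart_eval (N a b) x * chart_eval (lfield c e q) x / chart_eval q x ^+ 3.

Lemma csmooth_div (f h : 'rV[R]_D -> C) : (forall x, W x -> h x != 0) ->
  csmooth W f -> csmooth W h -> csmooth W (fun x => f x / h x).
Proof. by move=> h0 sf sh; apply: csmoothM => //; exact: csmoothV. Qed.

Lemma cpderiv_div (f h : 'rV[R]_D -> C) i x : (forall x, W x -> h x != 0) ->
  csmooth W f -> csmooth W h -> W x ->
  cpderiv (fun x => f x / h x) i x =
  (cpderiv f i x * h x - f x * cpderiv h i x) / h x ^+ 2.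
Proof.
move=> h0 sf sh Wx; rewrite (cpderivM i sf (csmoothV oW h0 sh) Wx).
rewrite (cpderivV i oW h0 sh Wx); move: (cpderiv f i x) (cpderiv h i x) => A B.
by field; exact: h0.
Qed.

Let qq0 x : W x -> chart_eval q x * chart_eval q x != 0.
Proof. by move=> Wx; rewrite mulf_neq0 // q0. Qed.

Lemma ratio_smooth : csmooth W ratio.
Proof. exact: csmooth_div q0 (chart_eval_smooth p) (chart_eval_smooth q). Qed.

Lemma ratio1_smooth a b : csmooth W (ratio1 a b).
Proof.
have sq := chart_eval_smooth q.
exact: (csmooth_div qq0 (chart_eval_smooth (N a b)) (csmoothM oW sq sq)).
Qed.

Lemma ratio_deriv i x : W x ->
  cpderiv ratio i x = \sum_a \sum_b left_translate s i x a b * ratio1 a b x.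
Proof.
move=> Wx; rewrite (cpderiv_div i q0 (chart_eval_smooth p) (chart_eval_smooth q) Wx).
rewrite !cpderiv_chart_eval //.
transitivity ((\sum_a \sum_b left_translate s i x a b * chart_eval (lfield a b p) x) /
    chart_eval q x - chart_eval p x / chart_eval q x ^+ 2 *
    (\sum_a \sum_b left_translate s i x a b * chart_eval (lfield a b q) x)).
  by apply: quotient_rule_split; exact: q0.
rewrite mulr_suml mulr_sumr -sumrN -big_split; apply: eq_bigr => a _ /=.
rewrite mulr_suml mulr_sumr -sumrN -big_split; apply: eq_bigr => b _ /=.
rewrite /ratio1 /N /wronskian chart_evalB !chart_evalM.
by apply: quotient_rule_term; exact: q0.
Qed.

Lemma ratio1_deriv a b i x : W x -> cpderiv (ratio1 a b) i x =
  \sum_c \sum_e left_translate s i x c e * ratio2 c e a b x.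
Proof.
move=> Wx; have sq := chart_eval_smooth q.
rewrite (cpderiv_div i qq0 (chart_eval_smooth (N a b)) (csmoothM oW sq sq) Wx).
rewrite (cpderivM i sq sq Wx) !cpderiv_chart_eval //.
transitivity ((\sum_c \sum_e left_translate s i x c e * chart_eval (lfield c e (N a b)) x) /
    chart_eval q x ^+ 2 - 2 * chart_eval (N a b) x / chart_eval q x ^+ 3 *
    (\sum_c \sum_e left_translate s i x c e * chart_eval (lfield c e q) x)).
  by apply: square_quotient_rule; exact: q0.
rewrite mulr_suml mulr_sumr -sumrN -big_split; apply: eq_bigr => c _ /=.
rewrite mulr_suml mulr_sumr -sumrN -big_split; apply: eq_bigr => e _ /=.
exact: square_quotient_term.
Qed.

Lemma ratio1_par a b x : par a b -> ratio1 a b x = 0.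
Proof.
move=> pab; rewrite /ratio1 /N (wronskian_eigen (par_p pab) (par_q pab)).
by rewrite chart_eval0 mul0r.
Qed.

(** The eigenvalue appears twice in the derivative of the Wronskian and twice in that of q ^+ 2.
    These contributions cancel, leaving the bracket. *)
Lemma ratio2_par a b c e x : W x -> par c e ->
  ratio2 c e a b x = (e == a)%:R * ratio1 c b x - (b == c)%:R * ratio1 a e x.
Proof.
move=> Wx pce.
have E1 : chart_eval (lfield c e (N a b)) x = wt c e *+ 2 * chart_eval (N a b) x +
    ((e == a)%:R * chart_eval (N c b) x - (b == c)%:R * chart_eval (N a e) x).
  apply: (etrans (congr1 (fun F => chart_eval F x)
    (lfield_wronskian a b (par_p pce) (par_q pce)))).
  exact: chart_eval_bracket.
have E2 : chart_eval (lfield c e q) x = wt c e * chart_eval q x.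
  exact: (etrans (congr1 (fun F => chart_eval F x) (par_q pce)) (chart_evalZ _ _ _)).
by rewrite /ratio2 E1 E2; apply: bracket_quotient; exact: q0.
Qed.

(** If (a, b) is parabolic, the Wronskian is the zero polynomial. Otherwise (b, a) is, and the
    bracket consists of the two diagonal terms, which vanish. *)
Lemma ratio2_swap a b x : W x -> par a a -> par b b -> par a b || par b a ->
  ratio2 b a a b x = 0.
Proof.
move=> Wx paa pbb /orP[pab|pba]; last first.
  by rewrite ratio2_par // !eqxx !ratio1_par // mulr0 subr0.
rewrite /ratio2 /N (wronskian_eigen (par_p pab) (par_q pab)).
by rewrite -mpolyC0 lfieldC mpolyC0 chart_eval0 !mulr0 !mul0r subrr.
Qed.

Lemma ratio1_nilpotent a b x : par a b || par b a -> ratio1 a b x * ratio1 b a x = 0.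
Proof.
by move=> /orP[pab|pba]; [rewrite ratio1_par ?mul0r|rewrite mulrC ratio1_par ?mul0r].
Qed.

Context (v : rel 'I_k) (hor : 'M[C]_k -> 'M[C]_k).
Hypothesis v_sym : ssrbool.symmetric v.
Hypothesis v_trans : transitive v.
Hypothesis card_v : #|[pred p : 'I_k * 'I_k | ~~ v p.1 p.2]| = D.
Hypothesis horE : forall Z, hor Z = mask v Z.
Hypothesis ug : forall x, W x -> gram hor s x \in unitmx.
Hypothesis par_total : forall a b, par a b || par b a.
Hypothesis v_par : forall a b, v a b -> par a b.

Let par_refl a : par a a. Proof. by have := par_total a a; rewrite orbb. Qed.

Lemma ratio_conformal x : W x ->
  \sum_i \sum_l cometric hor s x i l * (cpderiv ratio i x * cpderiv ratio l x) = 0.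
Proof.
apply: (horizontal_conformal v_sym card_v horE oW sS ug (F := ratio1)).
- by move=> a b y _ /v_par; exact: ratio1_par.
- exact: ratio_deriv.
- by move=> a b y _; exact: ratio1_nilpotent.
Qed.

Lemma ratio_tension x : W x ->
  \sum_i \sum_l cometric hor s x i l * cpderiv (cpderiv ratio l) i x +
  \sum_l real_complex R (drift (gram hor s) l x) * cpderiv ratio l x = 0.
Proof.
apply: (horizontal_tension v_sym v_trans card_v horE oW sS ug (F := ratio1) (F2 := ratio2)).
- exact: ratio1_smooth.
- by move=> a b y _ /v_par; exact: ratio1_par.
- exact: ratio_deriv.
- exact: ratio1_deriv.
- by move=> a b c e y Wy /v_par; exact: ratio2_par.
- move=> a b y Wy _.
  exact: (ratio2_swap Wy (par_refl a) (par_refl b) (par_total a b)).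
Qed.

End Ratio.
End PolynomialOnChart.

(** * Composition with harmonic functions of the plane *)

Section ComplexTopology.
Context {R : realType}.
Local Notation C := R[i].

Lemma normc_real (r : R) : `|real_complex R r| = real_complex R `|r|.
Proof. by rewrite normc_def /= expr0n addr0 sqrtr_sqr. Qed.

Lemma cRe_sum (I : Type) (r : seq I) (P : pred I) (F : I -> C) :
  complex.Re (\sum_(i <- r | P i) F i) = \sum_(i <- r | P i) complex.Re (F i).
Proof. exact: (big_morph _ cReD). Qed.

Lemma cIm_sum (I : Type) (r : seq I) (P : pred I) (F : I -> C) :
  complex.Im (\sum_(i <- r | P i) F i) = \sum_(i <- r | P i) complex.Im (F i).
Proof. exact: (big_morph _ cImD). Qed.

Lemma complex_cvg (T : Type) (F : set_system T) {FF : Filter F} (f : T -> C) (l : C) :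
  (fun t => complex.Re (f t)) @ F --> complex.Re l ->
  (fun t => complex.Im (f t)) @ F --> complex.Im l -> f @ F --> l.
Proof.
move=> fr fi; apply/cvgrPdist_lt => e e0.
(* The norm of R[i] takes values in R[i]; a positive element is a positive real. *)
have [r r0 eE] : exists2 r : R, 0 < r & e = real_complex R r.
  by move: e0; case: e => a b; rewrite ltcE /= => /andP[/eqP-> a0]; exists a.
have r2 : 0 < r / 2 by rewrite divr_gt0.
have nr : \forall t \near F, `|complex.Re l - complex.Re (f t)| < r / 2.
  exact: cvgr_dist_lt fr _ r2.
have ni : \forall t \near F, `|complex.Im l - complex.Im (f t)| < r / 2.
  exact: cvgr_dist_lt fi _ r2.
apply: filterS (filterI nr ni) => t [tr ti].
have -> : l - f t = real_complex R (complex.Re l - complex.Re (f t)) +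
    'i * real_complex R (complex.Im l - complex.Im (f t)).
  by apply: complexE; rewrite ?(cReD, cImD, cReN, cImN, cReM, cImM) /=; ring.
apply: le_lt_trans (ler_normD _ _) _.
rewrite normrM normCi mul1r !normc_real eE -rmorphD ltcR.
by rewrite [ltRHS]splitr ltrD.
Qed.

Lemma open_neq0 : open [set z : C | z != 0].
Proof.
rewrite (_ : [set z : C | z != 0] = ~` [set 0]).
  apply: closed_openC.
  exact: (accessible_closed_set1 (hausdorff_accessible (@norm_hausdorff C C))).
by apply/seteqP; split => z /eqP.
Qed.

Lemma csmooth_preimage d (W : set 'rV[R]_d) (f : 'rV[R]_d -> C) (V : set C) :
  open W -> csmooth W f -> open V -> open (W `&` f @^-1` V).
Proof.
move=> oW [fr fi] oV; rewrite openE => x [Wx Vx]; apply: filterI.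
  exact: open_nbhs_nbhs (conj oW Wx).
have fx : f @ x --> f x.
  exact: (complex_cvg (Ck_continuous (fr 0%N) Wx) (Ck_continuous (fi 0%N) Wx)).
exact: (fx _ (open_nbhs_nbhs (conj oV Vx))).
Qed.

End ComplexTopology.

Section HarmonicComposition.
Context {R : realType} {D : nat}.
Local Notation C := R[i].

Lemma drift_cst d (A : 'M[R]_d) l x : drift (fun=> A) l x = 0.
Proof.
rewrite /drift big1 // => i _; rewrite pderiv_cst add0r big1 // => j _.
rewrite /christoffel big1 ?mulr0 ?mul0r // => p _.
by rewrite !pderiv_cst addr0 subr0 mulr0.
Qed.

Definition plane_coord (y : 'rV[R]_2) : C := Complex (y 0 0) (y 0 1).

Lemma open_plane_coord (V : set C) : open V -> open (plane_coord @^-1` V).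
Proof.
move=> oV; rewrite openE => y Vy.
have py : plane_coord @ y --> plane_coord y.
  have c j : (fun z : 'rV[R]_2 => z 0 j) @ y --> y 0 j by exact: coord_continuous.
  exact: (@complex_cvg _ _ _ _ plane_coord (plane_coord y) (c 0) (c 1)).
exact: (py _ (open_nbhs_nbhs (conj oV Vy))).
Qed.

Lemma sum2 (F : 'I_2 -> 'I_2 -> R) :
  \sum_i \sum_l F i l = F 0 0 + F 0 1 + (F 1 0 + F 1 1).
Proof.
rewrite big_ord_recl big_ord_recl !big_ord0 big_ord_recl big_ord_recl !big_ord0.
rewrite big_ord_recl big_ord_recl !big_ord0 !addr0.
by rewrite (_ : lift ord0 ord0 = 1) //; exact: val_inj.
Qed.

Lemma sum_invmx1 (F : 'I_2 -> 'I_2 -> R) :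
  \sum_i \sum_l invmx (1%:M : 'M[R]_2) i l * F i l = F 0 0 + F 1 1.
Proof.
by rewrite invmx1 sum2 !mxE /= !mul1r !mul0r addr0 add0r.
Qed.

Lemma plane_laplace (W : set 'rV[R]_2) u y : open W -> W y -> Ck 2 W u ->
  laplace_beltrami (fun=> 1%:M) u y =
  pderiv (pderiv u 0) 0 y + pderiv (pderiv u 1) 1 y.
Proof.
move=> oW Wy cu.
have c1 i j : Ck 1 W (fun=> (1%:M : 'M[R]_2) i j) by exact: Ck_cst.
have u1 z : W z -> (1%:M : 'M[R]_2) \in unitmx by move=> _; exact: unitmx1.
apply: (etrans (laplace_beltramiE oW c1 u1 Wy cu)).
have d0 : \sum_l drift (fun=> (1%:M : 'M[R]_2)) l y * pderiv u l y = 0.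
  by rewrite big1 // => l _; rewrite drift_cst mul0r.
apply: (etrans (f_equal2 +%R (sum_invmx1 (fun i l => pderiv (pderiv u l) i y)) d0)).
exact: addr0.
Qed.

Context (g : 'rV[R]_D -> 'M[R]_D) (W : set 'rV[R]_D) (w : 'rV[R]_D -> C).
Hypothesis oW : open W.
Hypothesis cg : forall i j, Ck 1 W (fun y => g y i j).
Hypothesis ug : forall y, W y -> g y \in unitmx.
Hypothesis sg : forall y, W y -> (g y)^T = g y.
Hypothesis sw : csmooth W w.
Hypothesis conf : forall x, W x -> \sum_i \sum_l real_complex R (invmx (g x) i l) *
  (cpderiv w i x * cpderiv w l x) = 0.
Hypothesis tens : forall x, W x ->
  \sum_i \sum_l real_complex R (invmx (g x) i l) * cpderiv (cpderiv w l) i x +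
  \sum_l real_complex R (drift g l x) * cpderiv w l x = 0.

Let wv x : 'rV[R]_2 := \row_j (if j == 0 then complex.Re (w x) else complex.Im (w x)).

Let wv0 : (fun x => wv x 0 0) = fun x => complex.Re (w x).
Proof. by apply/funext => x; rewrite mxE. Qed.

Let wv1 : (fun x => wv x 0 1) = fun x => complex.Im (w x).
Proof. by apply/funext => x; rewrite mxE. Qed.

Let ord2 (j : 'I_2) : j = 0 \/ j = 1.
Proof. by case: j => -[|[|//]] i; [left|right]; exact: val_inj. Qed.

Let wv_Ck n j : Ck n W (fun x => wv x 0 j).
Proof. by case: (ord2 j) => ->; [rewrite wv0; exact: sw.1|rewrite wv1; exact: sw.2]. Qed.

Let plane_wv x : plane_coord (wv x) = w x.
Proof. by apply: complexE; rewrite /= mxE. Qed.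

Let kap p j x := \sum_i \sum_l invmx (g x) i l *
  (pderiv (fun y => wv y 0 p) i x * pderiv (fun y => wv y 0 j) l x).

Let tau j x := \sum_i \sum_l invmx (g x) i l * pderiv (pderiv (fun y => wv y 0 j) l) i x +
  \sum_l drift g l x * pderiv (fun y => wv y 0 j) l x.

Let tau0 j x : W x -> tau j x = 0.
Proof.
move=> /tens t.
have e1 : complex.Re (\sum_i \sum_l real_complex R (invmx (g x) i l) * cpderiv (cpderiv w l) i x +
  \sum_l real_complex R (drift g l x) * cpderiv w l x) = 0 by rewrite t.
have e2 : complex.Im (\sum_i \sum_l real_complex R (invmx (g x) i l) * cpderiv (cpderiv w l) i x +
  \sum_l real_complex R (drift g l x) * cpderiv w l x) = 0 by rewrite t.
case: (ord2 j) => ->; rewrite /tau.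
  rewrite wv0 -[RHS]e1 cReD !cRe_sum; apply: (f_equal2 +%R); apply: eq_bigr => i _.
    by rewrite cRe_sum; apply: eq_bigr => l _; rewrite cReM /= mul0r subr0.
  by rewrite cReM /= mul0r subr0.
rewrite wv1 -[RHS]e2 cImD !cIm_sum; apply: (f_equal2 +%R); apply: eq_bigr => i _.
  by rewrite cIm_sum; apply: eq_bigr => l _; rewrite cImM /= mul0r addr0.
by rewrite cImM /= mul0r addr0.
Qed.

Let kapC p j x : W x -> kap p j x = kap j p x.
Proof.
move=> Wx; rewrite /kap exchange_big; apply: eq_bigr => i _; apply: eq_bigr => l _.
by rewrite -{1}(invmx_sym sg Wx) mxE mulrC [_ * pderiv _ _ _]mulrC mulrC.
Qed.

(** The real part of kappa(w, w) = 0 says that both components of w have gradients of equal length,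
    the imaginary part that these are orthogonal. *)
Let kapE x : W x -> kap 0 0 x = kap 1 1 x /\ kap 0 1 x = 0.
Proof.
move=> Wx; have t := conf Wx.
have e1 : complex.Re (\sum_i \sum_l real_complex R (invmx (g x) i l) *
  (cpderiv w i x * cpderiv w l x)) = 0 by rewrite t.
have e2 : complex.Im (\sum_i \sum_l real_complex R (invmx (g x) i l) *
  (cpderiv w i x * cpderiv w l x)) = 0 by rewrite t.
split.
  apply/eqP; rewrite -subr_eq0 -[X in _ == X]e1 /kap wv0 wv1 cRe_sum -sumrB; apply/eqP.
  apply: eq_bigr => i _; rewrite cRe_sum -sumrB; apply: eq_bigr => l _.
  by rewrite !cReM /=; ring.
have : kap 0 1 x + kap 1 0 x = 0.
  rewrite -[RHS]e2 /kap wv0 wv1 cIm_sum -big_split.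
  apply: eq_bigr => i _; rewrite cIm_sum -big_split; apply: eq_bigr => l _.
  by rewrite cImM cImM /=; ring.
by rewrite (kapC 1 0 Wx) => h; lra.
Qed.

Let pderiv_comp2 V u i l x : open V -> (forall y, W y -> V (wv y)) -> Ck 2 V u ->
  W x -> pderiv (pderiv (u \o wv) l) i x =
  \sum_j ((\sum_p pderiv (pderiv u j) p (wv x) * pderiv (fun y => wv y 0 p) i x) *
            pderiv (fun y => wv y 0 j) l x +
          pderiv u j (wv x) * pderiv (pderiv (fun y => wv y 0 j) l) i x).
Proof.
move=> oV wV cu Wx.
have dw y n j : W y -> derivable (fun y => wv y 0 j) y (delta_mx 0 n).
  by move=> Wy; exact: (Ck_derivable n (wv_Ck 1 j) Wy).
have E y : W y -> pderiv (u \o wv) l y =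
    \sum_j pderiv u j (wv y) * pderiv (fun y => wv y 0 j) l y.
  by move=> Wy; apply: (pderiv_comp oV (wV _ Wy) (CkS cu)) => j; exact: dw.
have duj j : derivable (pderiv u j \o wv) x (delta_mx 0 i).
  by have [] := is_derive_comp oV (wV _ Wx) (Ck_pderiv j cu) (fun p => dw x i p Wx).
have dwj j := Ck_derivable i (Ck_pderiv l (wv_Ck 2 j)) Wx.
rewrite (pderiv_congr i oW E Wx) pderiv_sum; last first.
  by move=> j; exact: (derivableM (duj j) (dwj j)).
apply: eq_bigr => j _; rewrite (pderivM (duj j) (dwj j)).
by rewrite (pderiv_comp oV (wV _ Wx) (Ck_pderiv j cu) (fun p => dw x i p Wx)).
Qed.

(** By the chain rule, the Laplacian of f \o w is the Hessian of f contracted with [kap] plus the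
    gradient of f contracted with [tau]. As [kap] is a multiple of the identity, the first term is a
    multiple of the Laplacian of f. *)
Lemma harmonic_chart (V : set C) (f : C -> R) : open V ->
  (forall x, W x -> V (w x)) -> @Defs.harmonic R (plane R) V f ->
  Ck 2 W (f \o w) /\ forall x, W x -> laplace_beltrami g (f \o w) x = 0.
Proof.
move=> oV wV hf; pose u : 'rV[R]_2 -> R := f \o plane_coord.
have [cu lu] : Ck 2 (plane_coord @^-1` V) u /\ (forall y, (plane_coord @^-1` V) y ->
    laplace_beltrami (fun=> 1%:M) u y = 0).
  have [cu lu] := hf tt; split; first exact: (Ck_subset (fun y Vy => conj I Vy) cu).
  by move=> y Vy; exact: (lu y (conj I Vy)).
have oU := open_plane_coord oV.
have wU x : W x -> (plane_coord @^-1` V) (wv x) by move=> /wV; rewrite /= plane_wv.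
have -> : f \o w = u \o wv by apply/funext => x /=; rewrite -(plane_wv x).
have cuw : Ck 2 W (u \o wv) by exact: (Ck_comp oU oW wU cu (wv_Ck 2)).
split=> // x Wx.
have lu0 := lu _ (wU _ Wx); rewrite (plane_laplace oU (wU _ Wx) cu) in lu0.
rewrite (laplace_beltramiE oW cg ug Wx cuw).
transitivity (\sum_j \sum_p pderiv (pderiv u j) p (wv x) * kap p j x +
    \sum_j pderiv u j (wv x) * tau j x).
  have -> : \sum_l drift g l x * pderiv (u \o wv) l x =
      \sum_j pderiv u j (wv x) * \sum_l drift g l x * pderiv (fun y => wv y 0 j) l x.
    under [RHS]eq_bigr do rewrite mulr_sumr.
    rewrite [RHS]exchange_big; apply: eq_bigr => l _ /=.
    rewrite (pderiv_comp oU (wU _ Wx) (CkS cu)); last first.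
      by move=> j; exact: (Ck_derivable l (wv_Ck 1 j) Wx).
    by rewrite mulr_sumr; apply: eq_bigr => j _; ring.
  under [X in _ = _ + X]eq_bigr do rewrite mulrDr.
  rewrite [X in _ = _ + X]big_split /= addrA; congr (_ + _).
  rewrite -big_split /=.
  transitivity (\sum_j \sum_i \sum_l invmx (g x) i l *
     ((\sum_p pderiv (pderiv u j) p (wv x) * pderiv (fun y => wv y 0 p) i x) *
            pderiv (fun y => wv y 0 j) l x +
          pderiv u j (wv x) * pderiv (pderiv (fun y => wv y 0 j) l) i x)).
    rewrite [RHS]exchange_big; apply: eq_bigr => i _ /=.
    rewrite [RHS]exchange_big; apply: eq_bigr => l _ /=.
    by rewrite (pderiv_comp2 i l oU wU cu Wx) mulr_sumr.
  apply: eq_bigr => j _; under [X in _ = X + _]eq_bigr do rewrite mulr_sumr.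
  rewrite [X in _ = X + _]exchange_big mulr_sumr -big_split; apply: eq_bigr => i _ /=.
  under [X in _ = X + _]eq_bigr do rewrite mulr_sumr.
  rewrite [X in _ = X + _]exchange_big mulr_sumr -big_split; apply: eq_bigr => l _ /=.
  rewrite mulrDr mulr_suml mulr_sumr; congr (_ + _); last by ring.
  by apply: eq_bigr => p _; ring.
rewrite [X in _ + X]big1 ?addr0; last by move=> j _; rewrite tau0 ?mulr0.
have [k00 k01] := kapE Wx; have k10 := kapC 1 0 Wx.
have fin (a b c e k0 k1 k2 k3 : R) : k0 = k3 -> k1 = 0 -> k2 = 0 -> a + e = 0 ->
    a * k0 + b * k2 + (c * k1 + e * k3) = 0.
  by move=> -> -> -> ae; rewrite !mulr0 addr0 add0r -mulrDl ae mul0r.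
exact: (etrans (sum2 (fun j p => pderiv (pderiv u j) p (wv x) * kap p j x))
  (fin _ _ _ _ _ _ _ _ k00 k01 (etrans k10 k01) lu0)).
Qed.

End HarmonicComposition.

Section Submersion.
Import -(notations) mpoly.
Context {R : realType} {m n : nat}.
Local Notation C := R[i].
Local Notation k := (m + n)%N.
Context (X : topologicalType) (prX : unitary R k -> X) (hor : 'M[C]_k -> 'M[C]_k)
  (D : nat) (v : rel 'I_k).
Hypothesis v_sym : ssrbool.symmetric v.
Hypothesis v_trans : transitive v.
Hypothesis card_v : #|[pred p : 'I_k * 'I_k | ~~ v p.1 p.2]| = D.
Hypothesis horE : forall Z, hor Z = mask v Z.
Hypothesis v_par : forall a b : 'I_k, v a b -> parabolic a b.

Lemma parabolic_total (a b : 'I_k) : parabolic a b || parabolic b a.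
Proof. by rewrite /parabolic; case: (ltnP a m) => //= _; rewrite ?orbT. Qed.

Context (d : nat) (P Q : mpoly.mpoly (num_choices m n) C).
Hypothesis homP : homogeneous d P.
Hypothesis homQ : homogeneous d Q.
Context (A : set X) (Phi : X -> C).
Hypothesis PhiE : forall p, Phi (prX p) = Phi_hat P Q p.
Hypothesis AE : forall p, A (prX p) <-> Zset Q p.

(** Covers the group and its quotient alike: everything is computed on the lift, where Phi becomes a
    quotient of polynomials in the entries. *)
Lemma harmonic_morphism_submersed :
  @harmonic_morphism R (submersed prX hor D) (plane R) A Phi.
Proof.
move=> V f oV _ hf c W0 u0.
pose s := lmap c; pose q := gen_poly Q.
have oL : open (ldom c) := @ldom_open _ _ _ _ _ _ c.
have sL : mxsmooth (ldom c) (fun x => umx (s x)) := @lmap_smooth _ _ _ _ _ _ c.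
(* Two stages, since w is smooth only where q does not vanish. *)
pose W1 := ldom c `&` chart_eval s q @^-1` [set z | z != 0].
have oW1 : open W1.
  apply: csmooth_preimage => //; first exact: chart_eval_smooth.
  exact: open_neq0.
have sub1 : W1 `<=` ldom c by move=> x [].
have q1 x : W1 x -> chart_eval s q x != 0 by move=> [].
have s1 : mxsmooth W1 (fun x => umx (s x)).
  by move=> a b; exact: csmooth_subset sub1 (sL a b).
pose w := ratio s (gen_poly P) q.
have sw1 : csmooth W1 w by exact: ratio_smooth.
pose W := W1 `&` w @^-1` V.
have oW : open W by exact: csmooth_preimage.
have sub : W `<=` W1 by move=> x [].
have evalE F x : chart_eval s (gen_poly F) x = poly_phi F (s x).
  exact: mxeval_gen_poly.
have wE x : w x = Phi_hat P Q (s x).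
  exact: (f_equal2 (fun a b => a / b) (evalE P x) (evalE Q x)).
(* This makes the domain open without any continuity of [prX]: it is cut out by smooth functions of
   the lift. *)
have WE : W0 = W.
  apply/seteqP; split => x.
    move=> [Lx [/AE Zx Vx]]; split; last first.
      by rewrite /= wE -PhiE.
    by split => //=; rewrite /= evalE.
  move=> [[Lx qx] Vx]; split => //; split.
    by apply/AE; move: qx; rewrite /= evalE.
  by move: Vx; rewrite /= wE -PhiE.
have uE : u0 = f \o w.
  by apply/funext => x; rewrite /= wE -PhiE.
rewrite WE uE.
have sW : mxsmooth W (fun x => umx (s x)).
  by move=> a b; exact: csmooth_subset sub (s1 a b).
have ug x : W x -> gram hor s x \in unitmx.
  by move=> /sub/sub1; exact: (@lmap_immersion _ _ _ _ _ _ c).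
have qW x : W x -> chart_eval s q x != 0 by move=> /sub/q1.
have pP a b : parabolic a b ->
    lfield a b (gen_poly P) = (weight d a b : C) *: gen_poly P.
  exact: lfield_gen_poly.
have pQ a b : parabolic a b -> lfield a b q = (weight d a b : C) *: q.
  exact: lfield_gen_poly.
apply: (harmonic_chart oW (gram_Ck v_sym horE oW sW 1) ug
  (gram_sym v_sym horE oW sW) (csmooth_subset sub sw1) _ _ oV _ hf).
- move=> x Wx.
  exact: (ratio_conformal oW sW qW pP pQ v_sym card_v horE ug parabolic_total v_par Wx).
- move=> x Wx.
  exact: (ratio_tension oW sW qW pP pQ v_sym v_trans card_v horE ug parabolic_total v_par Wx).
- by move=> x [].
Qed.

End Submersion.

(** * Density of the set where a polynomial in the minors does not vanish *)

Section UnitModulus.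
Context {R : realType}.
Local Notation C := R[i].

Lemma poly_many_roots_eq0 (p : {poly C}) (z : nat -> C) :
  injective z -> (forall n, p.[z n] = 0) -> p = 0.
Proof.
move=> z_inj pz; apply/eqP/negPn/negP => p0.
have := max_poly_roots p0 (rs := [seq z n | n <- iota 0 (size p)]).
rewrite size_map size_iota ltnn map_inj_uniq ?iota_uniq //.
suff -> : all (root p) [seq z n | n <- iota 0 (size p)] by move=> /(_ isT isT).
by apply/allP => _ /mapP[n _ ->]; rewrite /root pz.
Qed.

(** The Cayley transform of the integers: an explicit infinite family on the unit circle. *)
Definition cayley_unit (n : nat) : C := (1 + 'i * n%:R) / (1 - 'i * n%:R).

Lemma real_line_neq0 (r : R) : 1 + 'i * real_complex R r != 0 :> C.
Proof.
apply/eqP => /(congr1 (@complex.Re R)); rewrite cReD cReM /= !mul0r mul1r subr0 addr0.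
by move/eqP; rewrite oner_eq0.
Qed.

Lemma cayley_denoms (n : nat) : 1 + 'i * n%:R != 0 :> C /\ 1 - 'i * n%:R != 0 :> C.
Proof.
have e : n%:R = real_complex R n%:R by rewrite rmorph_nat.
by rewrite e -mulrN -rmorphN !real_line_neq0.
Qed.

Lemma cayley_unit_norm n : (cayley_unit n)^* * cayley_unit n = 1.
Proof.
have [h1 h2] := cayley_denoms n.
rewrite /cayley_unit rmorphM fmorphV rmorphD rmorphB rmorphM rmorph1 rmorph_nat /=.
rewrite conjCi !mulNr opprK.
by field; rewrite h1 h2.
Qed.

Lemma cayley_unit_inj : injective cayley_unit.
Proof.
move=> n l; have [h1 h2] := cayley_denoms n; have [h3 h4] := cayley_denoms l.
rewrite /cayley_unit => /eqP; rewrite eqr_div // => /eqP E.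
have : 'i * n%:R = 'i * l%:R :> C.
  have E' : (1 + 'i * n%:R) * (1 - 'i * l%:R) - (1 + 'i * l%:R) * (1 - 'i * n%:R) = 0 :> C.
    by rewrite E subrr.
  have : 2 * ('i * n%:R - 'i * l%:R) = 0 :> C by rewrite -[RHS]E'; ring.
  by move/eqP; rewrite mulf_eq0 pnatr_eq0 /= subr_eq0 => /eqP.
move/(mulfI (neq0Ci C))/eqP; rewrite eqr_nat => /eqP; exact.
Qed.

(** \det (1 + t w) is a polynomial in t equal to 1 at t = 0, so it cannot vanish at infinitely many
    points of the unit circle. *)
Lemma unit_shift k (w : 'M[C]_k) :
  exists mu : C, mu^* * mu = 1 /\ 1%:M + mu *: w \in unitmx.
Proof.
pose p : {poly C} := \det (1%:M + 'X *: map_mx polyC w).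
have pE t : p.[t] = \det (1%:M + t *: w).
  rewrite -/(horner_eval t p) -det_map_mx map_mxD map_mx1 map_mxZ /= /horner_eval hornerX.
  by congr (\det (_ + _ *: _)); apply/matrixP => i j; rewrite !mxE hornerC.
have p0 : p != 0.
  apply/eqP => /(congr1 (fun r => r.[0])); rewrite pE scale0r addr0 det1 horner0.
  by move/eqP; rewrite oner_eq0.
have [n pn] : exists n, p.[cayley_unit n] != 0.
  apply: contrapT => /forallNP h; move/eqP: p0; apply.
  by apply: (poly_many_roots_eq0 cayley_unit_inj) => n; apply/eqP/negPn/negP; exact: h.
exists (cayley_unit n); split; first exact: cayley_unit_norm.
by rewrite unitmxE unitfE -pE.
Qed.

End UnitModulus.

Section CayleyPath.
Context {R : realType} {k : nat}.
Local Notation C := R[i].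
Implicit Types (V g : 'M[C]_k) (t a b : C).

(** The right-hand side is symmetric in a and b, and exchanging them exchanges [pencilN] and
    [pencilM]. This is why their quotient is unitary. *)
Lemma adj_pencil V a b : V ^t* *m V = 1%:M -> a^* = a -> b^* = b ->
  (a%:M + b *: V) ^t* *m (a%:M + b *: V) =
  (a * a + b * b)%:M + (a * b) *: (V + V ^t*).
Proof.
move=> VV aJ bJ.
have -> : (a%:M + b *: V) ^t* = a%:M + b *: V ^t*.
  apply/matrixP => i j; rewrite !mxE rmorphD rmorphM rmorphMn /= aJ bJ eq_sym.
  by [].
have e1 : (a%:M *m a%:M : 'M[C]_k) = (a * a)%:M by rewrite scalar_mxM.
have e2 : a%:M *m (b *: V) = (a * b) *: V by rewrite mul_scalar_mx scalerA.
have e3 : (b *: V ^t*) *m a%:M = (a * b) *: V ^t* by rewrite mul_mx_scalar scalerA.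
have e4 : (b *: V ^t*) *m (b *: V) = (b * b)%:M.
  by rewrite -scalemxAl -scalemxAr VV scalerA scale_scalar_mx mulr1.
rewrite mulmxDl !mulmxDr e1 e2 e3 e4 raddfD scalerDr /=.
by rewrite [_ *: _ + _%:M]addrC addrACA.
Qed.

(* pencilN V t *m invmx (pencilM V t) is the Cayley path from 1 at t = 0 to V at
   t = 1; it is unitary for real t. *)
Definition pencilN V t := (1 - t)%:M + (1 + t) *: V.
Definition pencilM V t := (1 + t)%:M + (1 - t) *: V.

Lemma pencil_unitary V g t : V ^t* *m V = 1%:M -> g \is unitarymx -> t^* = t ->
  pencilM V t \in unitmx -> g *m pencilN V t *m invmx (pencilM V t) \is unitarymx.
Proof.
move=> VV up tJ uM.
have p1 : g ^t* *m g = 1%:M by apply: mulmx1C; exact/unitarymxP.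
have a1 : (1 - t)^* = 1 - t by rewrite rmorphB rmorph1 /= tJ.
have b1 : (1 + t)^* = 1 + t by rewrite rmorphD rmorph1 /= tJ.
have NM : (pencilN V t) ^t* *m pencilN V t = (pencilM V t) ^t* *m pencilM V t.
  by rewrite /pencilN /pencilM !adj_pencil // addrC [(1 - t) * (1 + t)]mulrC [in RHS]addrC
    [(1 - t) * (1 - t) + _]addrC.
apply/unitarymxP/mulmx1C; rewrite !adjmxM.
transitivity ((invmx (pencilM V t)) ^t* *m ((pencilN V t) ^t* *m (g ^t* *m g) *m pencilN V t)
   *m invmx (pencilM V t)); first by rewrite !mulmxA.
rewrite p1 mulmx1 NM mulmxA -adjmxM mulmxV // -mulmxA mulmxV // mulmx1.
by rewrite trmx1 map_mx1.
Qed.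

(** The path with its denominator cleared: the adjugate replaces the inverse, so the entries are
    polynomials in t and the path is multiplied by [pencil_det]. *)
Definition pencil_poly V g : 'M[{poly C}]_k :=
  map_mx polyC g *m ((1 - 'X)%:M + (1 + 'X) *: map_mx polyC V) *m
    \adj ((1 + 'X)%:M + (1 - 'X) *: map_mx polyC V).

Definition pencil_det V : {poly C} := \det ((1 + 'X)%:M + (1 - 'X) *: map_mx polyC V).

Let horner_polyC t (A : 'M[C]_k) : map_mx (horner_eval t) (map_mx polyC A) = A.
Proof. by apply/matrixP => i j; rewrite !mxE /horner_eval hornerC. Qed.

Let horner_pencilM V t :
  map_mx (horner_eval t) ((1 + 'X)%:M + (1 - 'X) *: map_mx polyC V) = pencilM V t.
Proof.
rewrite map_mxD map_mxZ map_scalar_mx horner_polyC /= /horner_eval.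
by rewrite !hornerE.
Qed.

Lemma pencil_polyE V g t : map_mx (horner_eval t) (pencil_poly V g) =
  g *m pencilN V t *m \adj (pencilM V t).
Proof.
rewrite /pencil_poly !map_mxM map_mx_adj horner_pencilM horner_polyC.
rewrite map_mxD map_mxZ map_scalar_mx horner_polyC /= /horner_eval.
by rewrite !hornerE.
Qed.

Lemma pencil_detE V t : (pencil_det V).[t] = \det (pencilM V t).
Proof. by rewrite -[LHS]/(horner_eval t _) -det_map_mx horner_pencilM. Qed.

Lemma pencil_poly_inv V g t : pencilM V t \in unitmx ->
  map_mx (horner_eval t) (pencil_poly V g) =
  (pencil_det V).[t] *: (g *m pencilN V t *m invmx (pencilM V t)).
Proof.
by move=> uM; rewrite pencil_polyE pencil_detE /invmx uM -scalemxAr scalerA mulfV ?scale1r //.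
Qed.

End CayleyPath.

Section PolynomialLimits.
Context {R : realType}.
Local Notation C := R[i].

Section PointwiseForms.
Context {T : Type} {F : set_system T} {FF : Filter F}.
Implicit Types (f h : T -> C) (a b : C).

Lemma cvgD_pw f h a b : f @ F --> a -> h @ F --> b ->
  (fun t => f t + h t) @ F --> a + b.
Proof. exact: cvgD. Qed.

Lemma cvgM_pw f h a b : f @ F --> a -> h @ F --> b ->
  (fun t => f t * h t) @ F --> a * b.
Proof. by move=> fa hb; exact: (cvgM fa hb). Qed.

Lemma cvgV_pw f a : a != 0 -> f @ F --> a -> (fun t => (f t)^-1) @ F --> a^-1.
Proof. exact: cvgV. Qed.

End PointwiseForms.

Lemma real_complex_cvg (x : R) : real_complex R @ x --> real_complex R x.
Proof. by apply: complex_cvg => /=; [exact: cvg_id|exact: cvg_cst]. Qed.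

Lemma horner_cvg (p : {poly C}) (x : R) :
  (fun t : R => p.[real_complex R t]) @ x --> p.[real_complex R x].
Proof.
elim/poly_ind: p => [|p c IH].
  under eq_fun do rewrite horner0; rewrite horner0; exact: cvg_cst.
under eq_fun do rewrite hornerMXaddC; rewrite hornerMXaddC.
exact: (cvgD_pw (cvgM_pw IH (@real_complex_cvg x)) (cvg_cst c)).
Qed.

Lemma poly_real_roots_eq0 (p : {poly C}) (r : R) : 0 < r ->
  (forall t, `|t| <= r -> p.[real_complex R t] = 0) -> p = 0.
Proof.
move=> r0 pt; apply: (@poly_many_roots_eq0 _ _ (fun n => real_complex R (r / n.+1%:R))).
  move=> i j [] /(mulfI (lt0r_neq0 r0)) /invr_inj /eqP.
  by rewrite eqr_nat eqSS => /eqP.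
move=> n; apply: pt; rewrite ger0_norm; last by rewrite divr_ge0 // ltW.
by rewrite ler_pdivrMr // ler_pMr // ler1n.
Qed.

Lemma mxeval_horner k (N : 'M[{poly C}]_k) (F : mpoly.mpoly (k * k) C) :
  exists r : {poly C}, forall t, r.[t] = mxeval (map_mx (horner_eval t) N) F.
Proof.
move: F; apply: mpoly_mxind => [c|a b|F G [rF EF] [rG EG]|F G [rF EF] [rG EG]].
- by exists c%:P => t; rewrite hornerC mxevalC.
- by exists (N a b) => t; rewrite mxeval_coord mxE.
- by exists (rF + rG) => t; rewrite hornerD EF EG -rmorphD.
- by exists (rF * rG) => t; rewrite hornerM EF EG -rmorphM.
Qed.

End PolynomialLimits.

Arguments horner_cvg {R} p x.

Section Density.
Context {R : realType} {m n : nat}.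
Local Notation C := R[i].
Local Notation k := (m + n)%N.
Implicit Types (p q : unitary R k).

Lemma umx_continuous a b : continuous (fun p : unitary R k => umx p a b).
Proof.
move=> p; have c1 : umx @ p --> umx p by exact: (@initial_continuous _ _ set_val).
exact: (cvg_comp _ _ c1 (@coord_continuous _ _ _ a b (umx p))).
Qed.

Lemma mxeval_continuous (F : mpoly.mpoly (k * k) C) :
  continuous (fun p : unitary R k => mxeval (umx p) F).
Proof.
move: F; apply: mpoly_mxind => [c|a b|F G cF cG|F G cF cG].
- rewrite (_ : (fun p => _) = fun=> c); first exact: cst_continuous.
  by apply/funext => p; exact: mxevalC.
- rewrite (_ : (fun p => _) = fun p : unitary R k => umx p a b).
    exact: umx_continuous.
  by apply/funext => p; exact: mxeval_coord.
- rewrite (_ : (fun p => _) = fun p : unitary R k => mxeval (umx p) F + mxeval (umx p) G).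
    by move=> p; exact: (cvgD_pw (cF p) (cG p)).
  by apply/funext => p; exact: rmorphD.
- rewrite (_ : (fun p => _) = fun p : unitary R k => mxeval (umx p) F * mxeval (umx p) G).
    by move=> p; exact: (cvgM_pw (cF p) (cG p)).
  by apply/funext => p; exact: rmorphM.
Qed.

Lemma open_Zset (Q : mpoly.mpoly (num_choices m n) C) : open (Zset Q).
Proof.
rewrite (_ : Zset Q = (fun p => mxeval (umx p) (gen_poly Q)) @^-1` [set z | z != 0]).
  by apply: open_comp open_neq0 => p _; exact: mxeval_continuous.
by apply/seteqP; split => p; rewrite /Zset /= mxeval_gen_poly.
Qed.

Lemma unitary_nbhs p (B : set 'M[C]_k) (A : 'M[{poly C}]_k) (D : {poly C}) :
  open B -> B (umx p) -> D.[0] != 0 ->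
  D.[0]^-1 *: map_mx (horner_eval 0) A = umx p ->
  exists2 r : R, 0 < r & forall t : R, `|t| <= r -> D.[real_complex R t] != 0 /\
    B (D.[real_complex R t]^-1 *: map_mx (horner_eval (real_complex R t)) A).
Proof.
move=> oB Bp D0 Ap.
have D0' : D.[real_complex R 0] != 0 by rewrite rmorph0.
have nD : \forall t \near (0 : R), D.[real_complex R t] != 0.
  exact: (@horner_cvg R D 0 [set z : C | z != 0] (open_nbhs_nbhs (conj open_neq0 D0'))).
have cA : (fun t : R => D.[real_complex R t]^-1 *:
    map_mx (horner_eval (real_complex R t)) A) @ (0 : R) --> umx p.
  rewrite -Ap -(rmorph0 (real_complex R)); apply: mx_cvg => i j.
  under eq_fun do rewrite !mxE; rewrite !mxE /horner_eval.
  exact: (cvgM_pw (cvgV_pw D0' (horner_cvg D 0)) (horner_cvg (A i j) 0)).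
have [r r0 rP] := (nbhs_ballP _ _).1 (filterI nD (cA _ (open_nbhs_nbhs (conj oB Bp)))).
exists (r / 2); first by rewrite divr_gt0.
move=> t tr; apply: rP; rewrite -ball_normE /= sub0r normrN.
by apply: le_lt_trans tr _; rewrite gtr_pMr ?invf_lt1 ?ltr1n.
Qed.

(** An identity theorem: restricted to the cleared path, F is a polynomial in t that vanishes on a
    real interval, hence also at t = 1. *)
Lemma poly_phi_open_eq0 d (F : mpoly.mpoly (num_choices m n) C)
    (O : set (unitary R k)) p : homogeneous d F -> open O -> O p ->
  (forall q, O q -> poly_phi F q = 0) -> forall q, poly_phi F q = 0.
Proof.
move=> hF oO Op FO q.
(* With V = mu p^* q, the path from p ends at p V = mu q; mu makes the denominator 1 + V at t = 0
   invertible. *)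
have [mu [mu1 uV]] := unit_shift ((umx p) ^t* *m umx q).
set V := mu *: _ in uV.
have VV : V ^t* *m V = 1%:M.
  have -> : V ^t* = mu^* *: ((umx q) ^t* *m umx p).
    rewrite -[umx p in RHS](_ : ((umx p) ^t*) ^t* = umx p); last first.
      by apply/matrixP => i j; rewrite !adjmxE conjCK.
    by rewrite -adjmxM; apply/matrixP => i j; rewrite mxE [RHS]mxE !adjmxE !mxE rmorphM.
  rewrite -scalemxAl -scalemxAr scalerA mu1 scale1r.
  by rewrite mulmxA -[_ *m umx p *m _]mulmxA umxK mulmx1 umxVK.
have M0 : pencilM V 0 \in unitmx by rewrite /pencilM addr0 subr0 scale1r.
have N0 : pencilN V 0 = pencilM V 0 by rewrite /pencilM /pencilN addr0 subr0.
pose A := pencil_poly V (umx p); pose D := pencil_det V.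
have D0 : D.[0] != 0 by rewrite /D pencil_detE -unitfE -unitmxE.
have A0 : D.[0]^-1 *: map_mx (horner_eval 0) A = umx p.
  by rewrite pencil_poly_inv // scalerA mulVf // scale1r N0 -mulmxA mulmxV // mulmx1.
have [B oB BO] : exists2 B, open B & umx @^-1` B = O by exact: oO.
have Bp : B (umx p) by move: Op; rewrite -BO.
have [r r0 rP] := unitary_nbhs oB Bp D0 A0.
(* For small real t, A(t) / D(t) is a unitary matrix in O. Homogeneity transfers the vanishing of F
   to A(t). *)
have FA (t : R) : `|t| <= r ->
    minor_poly F (map_mx (horner_eval (real_complex R t)) A) = 0.
  move=> /rP[Dt Bt].
  have uM : pencilM V (real_complex R t) \in unitmx.
    by rewrite unitmxE unitfE -pencil_detE.
  have uc : D.[real_complex R t]^-1 *: map_mx (horner_eval (real_complex R t)) A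
      \is unitarymx.
    rewrite pencil_poly_inv // scalerA mulVf // scale1r.
    apply: pencil_unitary => //; first exact: umx_unitary.
    by apply: complexE; rewrite ?cReJ ?cImJ /= ?oppr0.
  have mc := mem_set (uc : @unitary_set R k _).
  pose c : unitary R k := exist (fun Z => Z \in @unitary_set R k) _ mc.
  have Oc : O c by rewrite -BO.
  rewrite (@minor_poly_eigen _ _ _ d F (D.[real_complex R t] ^+ m) (umx c)) //.
    by rewrite -[minor_poly _ _]/(poly_phi F c) FO // mulr0.
  move=> s; rewrite -mx_minorZ; congr mx_minor.
  by rewrite scalerA mulfV // scale1r.
have [f fE] := mxeval_horner A (gen_poly F).
have f0 : f = 0.
  apply: (poly_real_roots_eq0 r0) => t tr; rewrite fE mxeval_minor_poly.
  exact: FA.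
(* At t = 1 the numerator is 2 V and the denominator 2, so A(1) = D(1) mu q, where D(1) and mu are
   nonzero. *)
have := fE 1; rewrite f0 horner0 mxeval_minor_poly.
have M1 : pencilM V 1 = 2%:M by rewrite /pencilM subrr scale0r addr0.
have uM1 : pencilM V 1 \in unitmx.
  by rewrite M1 unitmxE det_scalar unitfE expf_neq0 // pnatr_eq0.
have N1 : pencilN V 1 = 2 *: V by rewrite /pencilN subrr raddf0 add0r.
have -> : map_mx (horner_eval 1) A = (D.[1] * mu) *: umx q.
  rewrite pencil_poly_inv // N1 M1 invmx_scalar mul_mx_scalar -scalemxAr scalerA.
  rewrite mulVf ?pnatr_eq0 // scale1r -scalemxAr mulmxA umxK mul1mx.
  by rewrite scalerA.
rewrite (@minor_poly_eigen _ _ _ d F ((D.[1] * mu) ^+ m) (umx q)) //; last first.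
  by move=> s; rewrite -mx_minorZ.
move/esym/eqP; rewrite mulf_eq0 -exprM expf_eq0 mulf_eq0 pencil_detE.
have /negbTE -> : \det (pencilM V 1) != 0 by rewrite -unitfE -unitmxE.
have /negbTE -> : mu != 0.
  by apply/eqP => mu0; move/eqP: mu1; rewrite mu0 mulr0 eq_sym oner_eq0.
by rewrite /= andbF /= => /eqP.
Qed.

End Density.

(** * Passage to the Grassmannian *)

Section ZeroSet.
Import -(notations) mpoly.
Context {R : realType} {m n : nat}.
Local Notation C := R[i].
Local Notation k := (m + n)%N.
Context (d : nat) (P Q : mpoly (num_choices m n) C).
Hypothesis homP : homogeneous d P.
Hypothesis homQ : homogeneous d Q.
Hypothesis indPQ : independent_on_unitary P Q.

Lemma independent_neq0 : exists z, poly_phi Q z != 0.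
Proof.
apply: contrapT => /forallNP Q0.
have [|_ /eqP] := indPQ (a := 0) (b := 1).
  by move=> z; rewrite mul0r add0r mul1r; apply/eqP/negPn/negP; exact: Q0.
by rewrite oner_eq0.
Qed.

Lemma dense_Zset : dense (Zset Q).
Proof.
move=> O [p Op] oO; apply: contrapT => OZ.
have [z /eqP] := independent_neq0; apply.
apply: (poly_phi_open_eq0 homQ oO Op) => q Oq.
by apply/eqP/negPn/negP => Qq; apply: OZ; exists q.
Qed.

Lemma nonconstant_Phi_hat : nonconstant_on (Zset Q) (Phi_hat P Q).
Proof.
have [x Zx] := independent_neq0.
apply: contrapT => cst; pose c := Phi_hat P Q x.
have PQ z : Zset Q z -> poly_phi P z = c * poly_phi Q z.
  move=> Zz; have <- : Phi_hat P Q z = c.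
    apply: contrapT => zx; apply: cst; exists z, x.
    by split; [exact: Zz|exact: Zx|exact: zx].
  by rewrite /Phi_hat divfK.
pose F := P + mpolyC _ (- c) * Q.
have FE z : poly_phi F z = poly_phi P z - c * poly_phi Q z.
  by rewrite /poly_phi mevalD mevalM mevalC mulNr.
have homF : homogeneous d F.
  rewrite /F mul_mpolyC; apply: dhomogD => //.
  exact: dhomogZ.
have F0 := poly_phi_open_eq0 homF (open_Zset Q) Zx.
have [|/eqP] := indPQ (a := 1) (b := - c).
  move=> z; rewrite mul1r mulNr -FE; apply: F0 => q Zq.
  by rewrite FE PQ // subrr.
by rewrite oner_eq0.
Qed.

(** The factor \det A ^+ d depends only on the degree, so it is common to P and Q and cancels in the
    quotient. *)
Lemma same_coset_poly_phi (p q : unitary R k) : same_coset p q ->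
  exists2 c : C, c != 0 & forall F : mpoly (num_choices m n) C,
    homogeneous d F -> poly_phi F q = c * poly_phi F p.
Proof.
move=> /asboolP[_ [A [B [uA _ ->]]] qE]; exists (\det A ^+ d).
  by rewrite expf_neq0 // -unitfE -unitmxE unitarymx_unit.
move=> F hF; apply: (@minor_poly_eigen _ _ _ d F (\det A) (umx p) (umx q)) => // r.
by rewrite qE mx_minor_block.
Qed.

Lemma same_coset_Phi_hat (p q : unitary R k) :
  same_coset p q -> Phi_hat P Q q = Phi_hat P Q p.
Proof.
move=> /same_coset_poly_phi[c c0 cE].
by rewrite /Phi_hat !cE // -mulf_div mulfV // mul1r.
Qed.

Lemma same_coset_Zset (p q : unitary R k) : same_coset p q -> Zset Q p -> Zset Q q.
Proof.
by move=> /same_coset_poly_phi[c c0 cE]; rewrite /Zset /= cE // mulf_eq0 negb_or c0.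
Qed.

Lemma pr_eqP (p q : unitary R k) : pr p = pr q -> same_coset p q.
Proof. by move=> /eqmodP. Qed.

Lemma pr_repr (x : grassmannian R m n) : pr (repr x) = x.
Proof. exact: reprK. Qed.

(** Off the image of Z_Q the value is 0, by division by zero, for every representative. Hence
    [Phi_quotE] holds without restriction on p. *)
Definition Phi_quot (x : grassmannian R m n) : C := Phi_hat P Q (repr x).

Lemma Phi_quotE p : Phi_quot (pr p) = Phi_hat P Q p.
Proof. by apply/esym/same_coset_Phi_hat/pr_eqP; rewrite pr_repr. Qed.

Lemma pr_Zset p : (pr @` Zset Q) (pr p) <-> Zset Q p.
Proof.
split=> [[q Zq /pr_eqP qp]|Zp]; last by exists p.
exact: same_coset_Zset qp Zq.
Qed.

Lemma open_pr_Zset : open (pr @` Zset Q).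
Proof.
(* Openness in the quotient topology is by definition openness of the preimage, and Z_Q is
   saturated. *)
suff o : open (pr @^-1` (pr @` Zset Q)) by exact: o.
rewrite (_ : _ @^-1` _ = Zset Q); first exact: open_Zset.
by apply/seteqP; split => p /= /pr_Zset.
Qed.

Lemma dense_pr_Zset : dense (pr @` Zset Q).
Proof.
move=> O [x Ox] oO.
have oO' : open (@pr R m n @^-1` O) by exact: oO.
have [|p [Op Zp]] := dense_Zset _ oO'; first by exists (repr x); rewrite /= pr_repr.
by exists (pr p); split => //; exists p.
Qed.

End ZeroSet.

(** * The two vertical relations: empty, and block diagonal *)

Lemma card_all_pairs k :
  #|[pred p : 'I_k * 'I_k | ~~ (fun _ _ : 'I_k => false) p.1 p.2]| = (k ^ 2)%N.
Proof.
rewrite (eq_card (B := predT)) // cardT.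
by rewrite -cardT card_prod card_ord mulnn.
Qed.

Section Blocks.
Context {m n : nat}.

Definition same_block (a b : 'I_(m + n)) := ((a < m) == (b < m))%N.

Lemma same_block_ll (i j : 'I_m) : same_block (lshift n i) (lshift n j) = true.
Proof. by rewrite /same_block /= !ltn_ord. Qed.

Lemma same_block_rr (i j : 'I_n) : same_block (rshift m i) (rshift m j) = true.
Proof. by rewrite /same_block /= !ltnNge !leq_addr. Qed.

Lemma same_block_lr (i : 'I_m) (j : 'I_n) : same_block (lshift n i) (rshift m j) = false.
Proof. by rewrite /same_block /= ltn_ord ltnNge leq_addr. Qed.

Lemma same_block_rl (i : 'I_n) (j : 'I_m) : same_block (rshift m i) (lshift n j) = false.
Proof. by rewrite /same_block /= ltn_ord ltnNge leq_addr. Qed.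

(** Two rectangular blocks of m n positions each: the real dimension of the Grassmannian. *)
Lemma card_off_diagonal :
  #|[pred p : 'I_(m + n) * 'I_(m + n) | ~~ same_block p.1 p.2]| = (2 * m * n)%N.
Proof.
rewrite -sum1_card big_mkcond /=.
rewrite -(pair_bigA _ (fun a b => if ~~ same_block a b then 1 else 0))%N /=.
rewrite big_split_ord /=.
transitivity ((\sum_(i < m) n) + \sum_(i < n) m)%N.
  congr (_ + _)%N; apply: eq_bigr => i _; rewrite big_split_ord /=.
    rewrite big1 => [|j _]; last by rewrite same_block_ll.
    by under eq_bigr do rewrite same_block_lr; rewrite sum_nat_const card_ord muln1.
  rewrite [X in (_ + X)%N]big1 => [|j _]; last by rewrite same_block_rr.
  by under eq_bigr do rewrite same_block_rl; rewrite sum_nat_const card_ord muln1 addn0.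
by rewrite !sum_nat_const !card_ord [(n * m)%N]mulnC addnn -mul2n mulnA.
Qed.

Lemma off_diagonalE (R : realType) (Z : 'M[R[i]]_(m + n)) :
  off_diagonal Z = mask same_block Z.
Proof.
apply/matrixP => a b; rewrite maskE /off_diagonal.
case: (split_ordP a) => i ->; case: (split_ordP b) => j ->.
- by rewrite block_mxEul same_block_ll mxE.
- by rewrite block_mxEur same_block_lr !mxE.
- by rewrite block_mxEdl same_block_rl !mxE.
- by rewrite block_mxEdr same_block_rr mxE.
Qed.

(** The isotropy algebra lies in the parabolic one, so the quotient has zero derivative along the
    fibres. *)
Lemma same_block_parabolic (a b : 'I_(m + n)) : same_block a b -> parabolic a b.
Proof. by rewrite /same_block /parabolic => /eqP ->; case: leqP; rewrite ?orbT. Qed.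

End Blocks.

Theorem theorem11p3 (R : realType) (m n : nat) (m_gt0 : (0 < m)%N)
    (n_gt0 : (0 < n)%N) (d : nat) (d_gt0 : (0 < d)%N)
    (P Q : mpoly.mpoly (num_choices m n) R[i])
    (homP : homogeneous d P) (homQ : homogeneous d Q)
    (indPQ : independent_on_unitary P Q) :
  [/\ open (Zset Q), dense (Zset Q),
      @harmonic_morphism R (unitary_manifold R (m + n)) (plane R)
        (Zset Q) (Phi_hat P Q)
    & nonconstant_on (Zset Q) (Phi_hat P Q)] /\
  exists Phi : grassmannian R m n -> R[i],
    (forall p, Zset Q p -> Phi (pr p) = Phi_hat P Q p) /\
    [/\ open (pr @` Zset Q), dense (pr @` Zset Q),
        @harmonic_morphism R (grassmannian_manifold R m n) (plane R)
          (pr @` Zset Q) Phi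
      & nonconstant_on (pr @` Zset Q) Phi].
Proof.
have dense_Q := dense_Zset homQ indPQ.
have nonconst := nonconstant_Phi_hat homP homQ indPQ.
split.
  split => //; first exact: open_Zset.
  (* For the group no position is vertical, and the mask is the identity. *)
  apply: (@harmonic_morphism_submersed R m n (unitary R (m + n)) id id ((m + n) ^ 2)
    (fun _ _ => false) _ _ (card_all_pairs _) _ _ d P Q homP homQ) => //.
  by move=> Z; apply/matrixP => a b; rewrite mxE.
exists (Phi_quot P Q); split; first by move=> p _; exact: (Phi_quotE homP homQ).
split.
- exact: (open_pr_Zset homQ).
- exact: (dense_pr_Zset homQ indPQ).
- apply: (@harmonic_morphism_submersed R m n (grassmannian R m n) pr off_diagonal
    (2 * m * n) (@same_block m n) _ _ card_off_diagonal (@off_diagonalE m n R)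
    same_block_parabolic d P Q homP homQ).
  + by move=> a b; rewrite /same_block eq_sym.
  + by move=> b a c; rewrite /same_block => /eqP ->.
  + exact: (Phi_quotE homP homQ).
  + exact: (pr_Zset homQ).
- have [x [y [Zx Zy xy]]] := nonconst.
  exists (pr x), (pr y); split; [by exists x|by exists y|].
  by rewrite !(Phi_quotE homP homQ).
Qed.
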